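(* Let $j\ge 1$ and let $f= f_1 \circ f_2 \circ \cdots \circ f_j$ be a finite composition of transcendental entire functions $f_1,\dots,f_j$, where $f_1$ has finite order and positive lower order, i.e. $\rho(f_1)<\infty$ and $\lambda(f_1)>0$. Then $Q_2(f)=A(f)$.
   Context: For a transcendental entire function $f$, $f^n$ denotes the $n$th iterate, and $M(r)=M(r,f)=\max_{|z|=r}|f(z)|$ for $r>0$; $M^n(r,f)$ denotes the $n$th iterate of the function $r\mapsto M(r,f)$. Order and lower order: $\rho(f)=\limsup_{r\to\infty}\frac{\log\log M(r,f)}{\log r}$, $\lambda(f)=\liminf_{r\to\infty}\frac{\log\log M(r,f)}{\log r}$. Fast escaping set: $A(f)=\{z\in\mathbb{C}:\text{ there exists }\ell\in\mathbb{N}\text{ such that }|f^{n+\ell}(z)|\ge M^n(R,f)\text{ for all }n\in\mathbb{N}\}$, where $R>0$ is large enough that $M(r,f)>r$ for all $r\ge R$ (the set does not depend on the choice of such $R$). For $\varepsilon\in(0,1)$ let $\mu_{2,\varepsilon}(r)=\exp((\log M(r,f))^{\varepsilon})$, defined for $r$ with $M(r,f)\ge 1$, and let $\mu_{2,\varepsilon}^n$ denote its $n$th iterate. The set $Q_2(f)$ consists of all $z\in\mathbb{C}$ for which there exist $\varepsilon\in(0,1)$, $\ell\in\mathbb{N}$ and $R>0$ with $\mu_{2,\varepsilon}(r)>r$ for all $r\ge R$, such that $|f^{n+\ell}(z)|\ge\mu_{2,\varepsilon}^n(R)$ for all $n\in\mathbb{N}$ (for given $\varepsilon$ the choice of such $R$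 does not affect the set). *)

(* Defs.v *)
From Stdlib Require Export Reals Lra.
From Coquelicot Require Export Coquelicot.
Open Scope R_scope.

Definition entire (f : C -> C) : Prop :=
  forall z : C, @ex_derive C_AbsRing C_NormedModule f z.

Definition polynomial (f : C -> C) : Prop :=
  exists (a : nat -> C) (n : nat),
    forall z : C, f z = sum_n (fun k => Cmult (a k) (Cpow z k)) n.

Definition transcendental_entire (f : C -> C) : Prop :=
  entire f /\ ~ polynomial f.

(* [compose F j] is F 1 o F 2 o ... o F j; the value F 0 is not used. *)
Fixpoint compose (F : nat -> C -> C) (j : nat) (z : C) : C :=
  match j with
  | O => z
  | S k => compose F k (F (S k) z)
  end.

(* M(r, f). For r >= 0 and f continuous the circle |z| = r is compact, so this
   supremum is finite and attained: it is max_{|z| = r} |f z|. *)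
Definition max_modulus (f : C -> C) (r : R) : R :=
  real (Lub_Rbar (fun y => exists z : C, Cmod z = r /\ y = Cmod (f z))).

(* lim sup and lim inf of a real function at +oo, with values in the extended
   reals: inf_x sup_{r > x} g r and sup_x inf_{r > x} g r. *)
Definition LimSup_p_infty (g : R -> R) : Rbar :=
  Rbar_glb (fun y => exists x : R,
    y = Lub_Rbar (fun v => exists r : R, x < r /\ v = g r)).

Definition LimInf_p_infty (g : R -> R) : Rbar :=
  Rbar_lub (fun y => exists x : R,
    y = Glb_Rbar (fun v => exists r : R, x < r /\ v = g r)).

Definition order (f : C -> C) : Rbar :=
  LimSup_p_infty (fun r => ln (ln (max_modulus f r)) / ln r).

Definition lower_order (f : C -> C) : Rbar :=
  LimInf_p_infty (fun r => ln (ln (max_modulus f r)) / ln r).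

Definition max_modulus_admissible (f : C -> C) (R0 : R) : Prop :=
  0 < R0 /\ forall r : R, R0 <= r -> r < max_modulus f r.

(* A(f), computed from a given R0 admissible for f; the set does not depend
   on the choice of such an R0. *)
Definition fast_escaping (f : C -> C) (R0 : R) (z : C) : Prop :=
  exists l : nat, forall n : nat,
    Nat.iter n (max_modulus f) R0 <= Cmod (Nat.iter (n + l) f z).

(* x ^ e for x >= 0 and e > 0. [Rpower] alone is not suitable at x = 0, as
   Rpower 0 e = 1. *)
Definition pos_power (x e : R) : R :=
  if Rlt_dec 0 x then Rpower x e else 0.

(* mu_{2,eps}(r); only meaningful where 1 <= max_modulus f r. *)
Definition mu2 (f : C -> C) (eps r : R) : R :=
  exp (pos_power (ln (max_modulus f r)) eps).

(* The condition 1 <= max_modulus f r says that mu_{2,eps} is defined at r. *)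
Definition mu2_admissible (f : C -> C) (eps R0 : R) : Prop :=
  0 < R0 /\
  forall r : R, R0 <= r -> 1 <= max_modulus f r /\ r < mu2 f eps r.

Definition Q2 (f : C -> C) (z : C) : Prop :=
  exists (eps : R) (l : nat) (R0 : R),
    0 < eps < 1 /\
    mu2_admissible f eps R0 /\
    forall n : nat,
      Nat.iter n (mu2 f eps) R0 <= Cmod (Nat.iter (n + l) f z).

(* Main.v *)
Require Import Defs.
From Stdlib Require Import Lia Psatz Classical ClassicalEpsilon FunctionalExtensionality.

(* Write f = h o g with h = f_1, and S = M(r, g). Since exp (s ^ a) <= M(s, h) <= exp (s ^ b)
   for large s, log M(r, f) <= S ^ b. Conversely, near a point z0 where
   |g z| (T - log |z|) ^ n is maximal on an annulus, g (z0 exp t) behaves like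
   g z0 exp (N t), so that the image under g of the disc of radius r ^ 8 contains a
   circle of radius at least S; with the three circles theorem this gives
   log M(r ^ K, f) >= S ^ (a m) with m as large as we please, K depending on m.
   Hence mu_{2,eps} (r ^ K) >= M(r, f) ^ K for large r, and by induction the iterates of
   mu_{2,eps} dominate those of M(., f). The converse follows from mu_{2,eps} <= M.

   The complex analysis rests on the mean value property, obtained from Goursat's
   lemma for rectangles in logarithmic coordinates. *)

(** * Complex differentiability and the exponential *)

(** Nothing is known about the growth of g, so M(r, f) and M(r ^ K, f) are both expressed through
    the same S, and only h is estimated. The gap between the exponents b and a eps is closed by
    enlarging the radius: convexity of log M in log r gives M(r ^ (2 m), g) >= S ^ m. The resulting
    inequality carries the same power K on both sides, which is why it can be iterated without
    further loss.

    A full circle is needed in the image of g because M(s, h) is attained at a point of |w| = s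
    whose argument is not controlled. The weight (T - log |z|) ^ n plays the part of the maximal
    term in Wiman-Valiron theory. It vanishes on the outer circle, which keeps the maximum away from
    it. With D the logarithmic distance to that circle, the logarithm of the weight has second
    derivative of order n / D ^ 2, so on the scale D / n, on which g oscillates, the error is of
    order 1 / n and a fixed n makes it small. No exceptional set of radii arises; this matters
    because the radii met by the iterates cannot be chosen. *)

Definition ccont (f : C -> C) (z : C) : Prop :=
  forall eps : R, 0 < eps -> exists d : R, 0 < d /\
    forall w : C, Cmod (w - z) < d -> Cmod (f w - f z) < eps.

(* Caratheodory's form of complex differentiability: it turns the rules of
   differentiation into algebraic identities. *)
Definition cdiff (f : C -> C) (z : C) : Prop :=
  exists phi : C -> C, ccont phi z /\
    forall w : C, f w = (f z + phi w * (w - z))%C.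

Lemma Cmod_minus_sym (z w : C) : Cmod (z - w) = Cmod (w - z).
Proof. rewrite <- Cmod_opp. f_equal. ring. Qed.

Lemma Cmod_triangle_rev (z w : C) : Cmod z - Cmod w <= Cmod (z - w).
Proof.
  assert (H := Cmod_triangle (z - w) w).
  replace (z - w + w)%C with z in H by ring. lra.
Qed.

Lemma Cmod_minus_le (z w : C) : Cmod (z - w) <= Cmod z + Cmod w.
Proof. rewrite <- (Cmod_opp w). apply Cmod_triangle. Qed.

Lemma ccont_const (c z : C) : ccont (fun _ => c) z.
Proof.
  intros eps He. exists 1. split; [lra|]. intros w _.
  replace (c - c)%C with (RtoC 0) by ring. now rewrite Cmod_0.
Qed.

Lemma ccont_id (z : C) : ccont (fun w => w) z.
Proof. intros eps He. exists eps. split; auto. Qed.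

Lemma ccont_plus (f g : C -> C) (z : C) :
  ccont f z -> ccont g z -> ccont (fun w => f w + g w)%C z.
Proof.
  intros Hf Hg eps He.
  destruct (Hf (eps / 2)) as (d1 & Hd1 & H1); [lra|].
  destruct (Hg (eps / 2)) as (d2 & Hd2 & H2); [lra|].
  exists (Rmin d1 d2). split; [now apply Rmin_pos|]. intros w Hw.
  replace (f w + g w - (f z + g z))%C with ((f w - f z) + (g w - g z))%C by ring.
  eapply Rle_lt_trans; [apply Cmod_triangle|].
  specialize (H1 w (Rlt_le_trans _ _ _ Hw (Rmin_l _ _))).
  specialize (H2 w (Rlt_le_trans _ _ _ Hw (Rmin_r _ _))). lra.
Qed.

Lemma ccont_bounded (f : C -> C) (z : C) : ccont f z ->
  exists d B : R, 0 < d /\ 0 < B /\ forall w, Cmod (w - z) < d -> Cmod (f w) < B.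
Proof.
  intros Hf. destruct (Hf 1) as (d & Hd & H); [lra|].
  exists d, (Cmod (f z) + 1). assert (H0 := Cmod_ge_0 (f z)).
  repeat split; try lra. intros w Hw. specialize (H w Hw).
  assert (H1 := Cmod_triangle_rev (f w) (f z)). lra.
Qed.

Lemma ccont_mult (f g : C -> C) (z : C) :
  ccont f z -> ccont g z -> ccont (fun w => f w * g w)%C z.
Proof.
  intros Hf Hg eps He.
  destruct (ccont_bounded f z Hf) as (d0 & B & Hd0 & HB & H0).
  assert (Hg0 := Cmod_ge_0 (g z)).
  destruct (Hf (eps / (2 * (Cmod (g z) + 1)))) as (d1 & Hd1 & H1).
  { apply Rdiv_lt_0_compat; lra. }
  destruct (Hg (eps / (2 * B))) as (d2 & Hd2 & H2).
  { apply Rdiv_lt_0_compat; lra. }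
  exists (Rmin d0 (Rmin d1 d2)). split; [repeat apply Rmin_pos; auto|]. intros w Hw.
  assert (Hw0 : Cmod (w - z) < d0) by (eapply Rlt_le_trans; [apply Hw|apply Rmin_l]).
  assert (Hw1 : Cmod (w - z) < d1).
  { eapply Rlt_le_trans; [apply Hw|]. eapply Rle_trans; [apply Rmin_r|apply Rmin_l]. }
  assert (Hw2 : Cmod (w - z) < d2).
  { eapply Rlt_le_trans; [apply Hw|]. eapply Rle_trans; [apply Rmin_r|apply Rmin_r]. }
  replace (f w * g w - f z * g z)%C
    with (f w * (g w - g z) + g z * (f w - f z))%C by ring.
  eapply Rle_lt_trans; [apply Cmod_triangle|]. rewrite !Cmod_mult.
  specialize (H0 w Hw0). specialize (H1 w Hw1). specialize (H2 w Hw2).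
  assert (A1 : Cmod (f w) * Cmod (g w - g z) <= B * (eps / (2 * B))).
  { apply Rmult_le_compat; auto using Cmod_ge_0; lra. }
  assert (A2 : Cmod (g z) * Cmod (f w - f z)
     < (Cmod (g z) + 1) * (eps / (2 * (Cmod (g z) + 1)))).
  { apply Rle_lt_trans with (Cmod (g z) * (eps / (2 * (Cmod (g z) + 1)))).
    - apply Rmult_le_compat_l; lra.
    - apply Rmult_lt_compat_r; [apply Rdiv_lt_0_compat|]; lra. }
  replace (B * (eps / (2 * B))) with (eps / 2) in A1 by (field; lra).
  replace ((Cmod (g z) + 1) * (eps / (2 * (Cmod (g z) + 1)))) with (eps / 2) in A2
    by (field; lra).
  lra.
Qed.

Lemma ccont_comp (f g : C -> C) (z : C) :
  ccont g z -> ccont f (g z) -> ccont (fun w => f (g w)) z.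
Proof.
  intros Hg Hf eps He. destruct (Hf eps He) as (d1 & Hd1 & H1).
  destruct (Hg d1 Hd1) as (d2 & Hd2 & H2). exists d2. split; auto.
Qed.

Lemma ccont_ext_loc (f g : C -> C) (z : C) (d : R) : 0 < d ->
  (forall w, Cmod (w - z) < d -> f w = g w) -> ccont f z -> ccont g z.
Proof.
  intros Hd Hfg Hf eps He. destruct (Hf eps He) as (d1 & Hd1 & H1).
  exists (Rmin d d1). split; [now apply Rmin_pos|]. intros w Hw.
  rewrite <- !Hfg.
  - apply H1. eapply Rlt_le_trans; [apply Hw|apply Rmin_r].
  - replace (z - z)%C with (RtoC 0) by ring. now rewrite Cmod_0.
  - eapply Rlt_le_trans; [apply Hw|apply Rmin_l].
Qed.

Lemma cdiff_ccont (f : C -> C) (z : C) : cdiff f z -> ccont f z.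
Proof.
  intros (phi & Hphi & Hf).
  assert (H : ccont (fun w => f z + phi w * (w + - z))%C z).
  { apply ccont_plus; [apply ccont_const|]. apply ccont_mult; [assumption|].
    apply ccont_plus; [apply ccont_id|apply ccont_const]. }
  eapply ccont_ext_loc; [apply Rlt_0_1| |apply H]. intros w _. now rewrite (Hf w).
Qed.

Lemma cdiff_const (c z : C) : cdiff (fun _ => c) z.
Proof. exists (fun _ => RtoC 0). split; [apply ccont_const|]. intros w. ring. Qed.

Lemma cdiff_id (z : C) : cdiff (fun w => w) z.
Proof. exists (fun _ => RtoC 1). split; [apply ccont_const|]. intros w. ring. Qed.

Lemma cdiff_plus (f g : C -> C) (z : C) :
  cdiff f z -> cdiff g z -> cdiff (fun w => f w + g w)%C z.
Proof.
  intros (p & Hp & Hf) (q & Hq & Hg). exists (fun w => p w + q w)%C.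
  split; [now apply ccont_plus|]. intros w. rewrite (Hf w), (Hg w). ring.
Qed.

Lemma cdiff_mult (f g : C -> C) (z : C) :
  cdiff f z -> cdiff g z -> cdiff (fun w => f w * g w)%C z.
Proof.
  intros Hf0 (q & Hq & Hg). assert (Hc := cdiff_ccont f z Hf0).
  destruct Hf0 as (p & Hp & Hf).
  exists (fun w => p w * g z + f w * q w)%C. split.
  - apply ccont_plus; apply ccont_mult; auto using ccont_const.
  - intros w. rewrite (Hg w), (Hf w). ring.
Qed.

Lemma cdiff_comp (f g : C -> C) (z : C) :
  cdiff g z -> cdiff f (g z) -> cdiff (fun w => f (g w)) z.
Proof.
  intros Hg0 (p & Hp & Hf). assert (Hc := cdiff_ccont g z Hg0).
  destruct Hg0 as (q & Hq & Hg).
  exists (fun w => p (g w) * q w)%C. split.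
  - apply ccont_mult; [|assumption]. now apply ccont_comp.
  - intros w. rewrite (Hf (g w)). rewrite (Hg w) at 2. ring.
Qed.

Lemma cdiff_ext (f g : C -> C) (z : C) :
  (forall w, f w = g w) -> cdiff f z -> cdiff g z.
Proof.
  intros H (p & Hp & Hf). exists p. split; [assumption|].
  intros w. rewrite <- !H. apply Hf.
Qed.

Lemma cdiff_intro (f : C -> C) (z l : C) :
  (forall eps, 0 < eps -> exists d, 0 < d /\ forall w, Cmod (w - z) < d ->
     Cmod (f w - f z - l * (w - z)) <= eps * Cmod (w - z)) -> cdiff f z.
Proof.
  intros H.
  exists (fun w => if Ceq_dec w z then l else ((f w - f z) / (w - z))%C). split.
  - intros eps He. destruct (H (eps / 2)) as (d & Hd & Hl); [lra|].
    exists d. split; [assumption|]. intros w Hw.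
    destruct (Ceq_dec z z) as [_|n]; [|now elim n].
    destruct (Ceq_dec w z) as [E|n].
    + replace (l - l)%C with (RtoC 0) by ring. now rewrite Cmod_0.
    + assert (Hn : (w - z)%C <> 0) by (now apply Cminus_eq_contra).
      assert (Hp : 0 < Cmod (w - z)) by (now apply Cmod_gt_0).
      replace ((f w - f z) / (w - z) - l)%C
        with ((f w - f z - l * (w - z)) / (w - z))%C by (field; exact Hn).
      rewrite Cmod_div by exact Hn. specialize (Hl w Hw).
      apply Rle_lt_trans with (eps / 2); [|lra].
      apply Rmult_le_reg_r with (Cmod (w - z)); [assumption|].
      unfold Rdiv. rewrite Rmult_assoc, Rinv_l by lra. lra.
  - intros w. destruct (Ceq_dec w z) as [->|n].
    + ring.
    + assert (Hn : (w - z)%C <> 0) by (now apply Cminus_eq_contra).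
      field. exact Hn.
Qed.

Lemma cdiff_elim (f : C -> C) (z : C) : cdiff f z ->
  exists l : C, forall eps, 0 < eps -> exists d, 0 < d /\ forall w, Cmod (w - z) < d ->
     Cmod (f w - f z - l * (w - z)) <= eps * Cmod (w - z).
Proof.
  intros (p & Hp & Hf). exists (p z). intros eps He.
  destruct (Hp eps He) as (d & Hd & H). exists d. split; [assumption|]. intros w Hw.
  rewrite (Hf w).
  replace (f z + p w * (w - z) - f z - p z * (w - z))%C
    with ((p w - p z) * (w - z))%C by ring.
  rewrite Cmod_mult. apply Rmult_le_compat_r; [apply Cmod_ge_0|].
  left. now apply H.
Qed.

Lemma cdiff_inv (z : C) : z <> 0 -> cdiff Cinv z.
Proof.
  intros Hz.
  (* The identity must hold at every [w], also at [w = 0], where the convention [/ 0 = 0] forces the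
     value [/ (z * z)]. *)
  exists (fun w => if Ceq_dec w 0 then (/ (z * z))%C else (- / (z * w))%C). split.
  - assert (Hz0 : 0 < Cmod z) by now apply Cmod_gt_0.
    intros eps He.
    exists (Rmin (Cmod z / 2) (eps * Cmod z ^ 3 / 4)). split.
    { apply Rmin_pos; [lra|]. assert (0 < Cmod z ^ 3) by now apply pow_lt.
      assert (0 < eps * Cmod z ^ 3) by now apply Rmult_lt_0_compat. lra. }
    intros w Hw.
    assert (H1 : Cmod (w - z) < Cmod z / 2)
      by (eapply Rlt_le_trans; [apply Hw|apply Rmin_l]).
    assert (H2 : Cmod (w - z) < eps * Cmod z ^ 3 / 4)
      by (eapply Rlt_le_trans; [apply Hw|apply Rmin_r]).
    assert (H3 := Cmod_triangle_rev z w). rewrite Cmod_minus_sym in H3.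
    destruct (Ceq_dec z 0) as [E|_]; [contradiction|].
    destruct (Ceq_dec w 0) as [E|Hw0].
    { exfalso. rewrite E, Cmod_0 in H3. rewrite E in H1. lra. }
    replace (- / (z * w) - - / (z * z))%C with ((w - z) / (z * z * w))%C
      by (field; auto).
    rewrite Cmod_div by (repeat apply Cmult_neq_0; auto). rewrite !Cmod_mult.
    assert (H4 : 0 < Cmod z * Cmod z * (Cmod z / 2))
      by (repeat apply Rmult_lt_0_compat; lra).
    assert (H5 : Cmod z * Cmod z * (Cmod z / 2) <= Cmod z * Cmod z * Cmod w).
    { apply Rmult_le_compat_l; [|lra]. apply Rmult_le_pos; lra. }
    apply Rmult_lt_reg_r with (Cmod z * Cmod z * Cmod w); [lra|].
    unfold Rdiv. rewrite Rmult_assoc, Rinv_l, Rmult_1_r by lra.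
    apply Rlt_le_trans with (eps * (Cmod z * Cmod z * (Cmod z / 2))).
    + assert (0 < eps * Cmod z ^ 3) by (apply Rmult_lt_0_compat; [|apply pow_lt]; auto).
      replace (eps * (Cmod z * Cmod z * (Cmod z / 2)))
        with (eps * Cmod z ^ 3 / 2) by field. lra.
    + apply Rmult_le_compat_l; lra.
  - intros w. destruct (Ceq_dec w 0) as [->|Hw].
    + replace (/ 0)%C with (RtoC 0). field. exact Hz.
      unfold Cinv, RtoC. cbn. f_equal; unfold Rdiv; ring.
    + field. auto.
Qed.

Definition cexp (z : C) : C := (exp (fst z) * cos (snd z), exp (fst z) * sin (snd z)).

Lemma cexp_plus (z w : C) : cexp (z + w) = (cexp z * cexp w)%C.
Proof.
  unfold cexp, Cplus, Cmult. cbn [fst snd].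
  rewrite exp_plus, cos_plus, sin_plus. f_equal; ring.
Qed.

Lemma cexp_0 : cexp 0 = 1.
Proof. unfold cexp, RtoC. cbn. rewrite exp_0, cos_0, sin_0. f_equal; ring. Qed.

Lemma Cmod_cexp (z : C) : Cmod (cexp z) = exp (fst z).
Proof.
  unfold cexp, Cmod. cbn [fst snd].
  replace ((exp (fst z) * cos (snd z)) ^ 2 + (exp (fst z) * sin (snd z)) ^ 2)
    with (exp (fst z) ^ 2).
  - rewrite sqrt_pow2; [reflexivity|left; apply exp_pos].
  - assert (H := sin2_cos2 (snd z)). unfold Rsqr in H.
    transitivity (exp (fst z) ^ 2 * (sin (snd z) * sin (snd z) + cos (snd z) * cos (snd z))).
    + rewrite H. ring.
    + ring.
Qed.

Lemma cexp_shift (x y : R) : cexp (x, y + 2 * PI) = cexp (x, y).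
Proof.
  unfold cexp. cbn [fst snd]. now rewrite cos_plus, sin_plus, cos_2PI, sin_2PI,
    !Rmult_1_r, !Rmult_0_r, Rminus_0_r, Rplus_0_r.
Qed.

Lemma is_derive_remainder (f : R -> R) (l : R) : is_derive f 0 l ->
  forall eps, 0 < eps -> exists d, 0 < d /\ forall x, Rabs x < d ->
    Rabs (f x - f 0 - l * x) <= eps * Rabs x.
Proof.
  intros H eps He. apply is_derive_Reals in H.
  destruct (H eps He) as (d & Hd). exists d. split; [apply cond_pos|]. intros x Hx.
  destruct (Req_dec x 0) as [->|Hx0].
  - rewrite Rabs_R0. replace (f 0 - f 0 - l * 0) with 0 by ring. rewrite Rabs_R0. lra.
  - specialize (Hd x Hx0 Hx). rewrite Rplus_0_l in Hd.
    replace (f x - f 0 - l * x) with (((f x - f 0) / x - l) * x) by (field; auto).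
    rewrite Rabs_mult. apply Rmult_le_compat_r; [apply Rabs_pos|lra].
Qed.

Lemma fst_snd_Cmod (z : C) : Rabs (fst z) <= Cmod z /\ Rabs (snd z) <= Cmod z.
Proof.
  assert (H := Rmax_Cmod z). split; eapply Rle_trans; try apply H.
  apply Rmax_l. apply Rmax_r.
Qed.

Lemma Cmod_le_sum (z : C) : Cmod z <= Rabs (fst z) + Rabs (snd z).
Proof.
  destruct z as [x y]. cbn [fst snd].
  replace ((x, y) : C) with (RtoC x + RtoC y * Ci)%C.
  - eapply Rle_trans; [apply Cmod_triangle|].
    rewrite Cmod_mult, Cmod_Ci, !Cmod_R. lra.
  - unfold RtoC, Ci, Cmult, Cplus. cbn. f_equal; ring.
Qed.

(** The first-order expansions of the real [exp], [cos] and [sin] give the derivative at 0; the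
    addition law carries it to every [z]. *)
Lemma cdiff_cexp (z : C) : cdiff cexp z.
Proof.
  assert (H0 : cdiff cexp 0).
  { apply cdiff_intro with (l := RtoC 1). intros eps He.
    (* Each coordinate of the remainder will be at most [3 * (e * r)], so [6 * e <= eps] suffices;
       [e <= 1] together with [r < e / 2] keeps [exp x] below 2. *)
    set (e := Rmin (eps / 8) 1).
    assert (He0 : 0 < e) by (apply Rmin_pos; lra).
    assert (He1 : e <= 1) by apply Rmin_r.
    assert (He8 : e <= eps / 8) by apply Rmin_l.
    destruct (is_derive_remainder exp 1) with (eps := e) as (d1 & Hd1 & H1); auto.
    { assert (E := is_derive_exp 0). rewrite exp_0 in E. exact E. }
    destruct (is_derive_remainder cos 0) with (eps := e) as (d2 & Hd2 & H2); auto.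
    { auto_derive; auto. rewrite sin_0. ring. }
    destruct (is_derive_remainder sin 1) with (eps := e) as (d3 & Hd3 & H3); auto.
    { auto_derive; auto. rewrite cos_0. ring. }
    exists (Rmin (Rmin d1 (e / 2)) (Rmin d2 d3)). split.
    { repeat apply Rmin_pos; lra. }
    intros w Hw. replace (w - 0)%C with w in * by ring.
    destruct (fst_snd_Cmod w) as [Hx Hy]. destruct w as [x y]. cbn [fst snd] in *.
    set (r := Cmod (x, y)) in *.
    assert (Hr1 : r < d1).
    { eapply Rlt_le_trans; [apply Hw|]. eapply Rle_trans; [apply Rmin_l|apply Rmin_l]. }
    assert (Hr0 : r < e / 2).
    { eapply Rlt_le_trans; [apply Hw|]. eapply Rle_trans; [apply Rmin_l|apply Rmin_r]. }
    assert (Hr2 : r < d2).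
    { eapply Rlt_le_trans; [apply Hw|]. eapply Rle_trans; [apply Rmin_r|apply Rmin_l]. }
    assert (Hr3 : r < d3).
    { eapply Rlt_le_trans; [apply Hw|]. eapply Rle_trans; [apply Rmin_r|apply Rmin_r]. }
    specialize (H1 x ltac:(lra)). specialize (H2 y ltac:(lra)). specialize (H3 y ltac:(lra)).
    rewrite exp_0 in H1. rewrite cos_0 in H2. rewrite sin_0 in H3.
    replace (cos y - 1 - 0 * y) with (cos y - 1) in H2 by ring.
    replace (sin y - 0 - 1 * y) with (sin y - y) in H3 by ring.
    rewrite Rmult_1_l in H1.
    eapply Rle_trans; [apply Cmod_le_sum|].
    unfold cexp, Cminus, Cplus, Copp, Cmult, RtoC. cbn [fst snd].
    rewrite exp_0, cos_0, sin_0.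
    assert (Hr : 0 <= r) by apply Cmod_ge_0.
    assert (K1 : Rabs (exp x - 1 - x) <= e * r).
    { eapply Rle_trans; [apply H1|]. apply Rmult_le_compat_l; lra. }
    assert (K2 : Rabs (cos y - 1) <= e * r).
    { eapply Rle_trans; [apply H2|]. apply Rmult_le_compat_l; lra. }
    assert (K3 : Rabs (sin y - y) <= e * r).
    { eapply Rle_trans; [apply H3|]. apply Rmult_le_compat_l; lra. }
    assert (Her : e * r <= r) by nra.
    assert (K4 : Rabs (exp x - 1) <= 2 * r).
    { replace (exp x - 1) with ((exp x - 1 - x) + x) by ring.
      eapply Rle_trans; [apply Rabs_triang|]. lra. }
    assert (K5 : Rabs (exp x) <= 2).
    { replace (exp x) with ((exp x - 1) + 1) by ring.
      eapply Rle_trans; [apply Rabs_triang|]. rewrite Rabs_R1. lra. }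
    assert (L1 : Rabs (exp x * cos y - 1 - x) <= 3 * (e * r)).
    { replace (exp x * cos y - 1 - x)
        with (exp x * (cos y - 1) + (exp x - 1 - x)) by ring.
      eapply Rle_trans; [apply Rabs_triang|]. rewrite Rabs_mult.
      assert (Rabs (exp x) * Rabs (cos y - 1) <= 2 * (e * r)).
      { apply Rmult_le_compat; auto using Rabs_pos. } lra. }
    assert (L2 : Rabs (exp x * sin y - y) <= 3 * (e * r)).
    { replace (exp x * sin y - y)
        with (exp x * (sin y - y) + (exp x - 1) * y) by ring.
      eapply Rle_trans; [apply Rabs_triang|]. rewrite !Rabs_mult.
      assert (Rabs (exp x) * Rabs (sin y - y) <= 2 * (e * r)).
      { apply Rmult_le_compat; auto using Rabs_pos. }
      assert (Rabs (exp x - 1) * Rabs y <= (2 * r) * (e / 2)).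
      { apply Rmult_le_compat; auto using Rabs_pos. lra. } lra. }
    match goal with |- Rabs ?a + Rabs ?b <= _ =>
      replace a with (exp x * cos y - 1 - x) by ring;
      replace b with (exp x * sin y - y) by ring end.
    nra. }
  assert (Hd : cdiff (fun w => cexp z * cexp (w + - z))%C z).
  { apply cdiff_mult; [apply cdiff_const|]. apply cdiff_comp.
    - apply cdiff_plus; [apply cdiff_id|apply cdiff_const].
    - replace (z + - z)%C with (RtoC 0) by ring. exact H0. }
  eapply cdiff_ext; [|apply Hd]. intros w. cbv beta.
  rewrite <- cexp_plus. f_equal. ring.
Qed.

(** The passage from Coquelicot's complex derivative to [cdiff]: the little-o condition is
    instantiated with the neighbourhood filter of [z] itself. *)
Lemma cdiff_of_ex_derive (f : C -> C) (z : C) :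
  @ex_derive C_AbsRing C_NormedModule f z -> cdiff f z.
Proof.
  intros (l & _ & H). apply cdiff_intro with (l := l). intros eps He.
  destruct (H z (fun P HP => HP) (mkposreal eps He)) as (d & Hd).
  exists d. split; [apply cond_pos|]. intros w Hw.
  specialize (Hd w Hw). replace (l * (w - z))%C with ((w - z) * l)%C by ring.
  exact Hd.
Qed.

(** The closed range of angles presents an annulus as the image under [cexp] of a compact
    rectangle. *)
Lemma polar_form (z : C) : z <> 0 ->
  exists y : R, 0 <= y <= 2 * PI /\ z = cexp (ln (Cmod z), y).
Proof.
  intros Hz. assert (Hr : 0 < Cmod z) by now apply Cmod_gt_0.
  assert (H2 := Cmod2_alt z). destruct z as [a b]. unfold Re, Im in H2. cbn [fst snd] in H2.
  set (r := Cmod (a, b)) in *.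
  assert (Ha : -1 <= a / r <= 1).
  { split; apply Rmult_le_reg_r with r; auto; unfold Rdiv;
      rewrite ?Rmult_assoc, ?Rinv_l by lra; nra. }
  assert (Hc := cos_acos (a / r) Ha). assert (Hs := sin_acos (a / r) Ha).
  assert (Hsq : sqrt (1 - (a / r)²) = Rabs b / r).
  { apply sqrt_lem_1.
    - unfold Rsqr. nra.
    - apply Rmult_le_pos; [apply Rabs_pos|left; now apply Rinv_0_lt_compat].
    - replace (1 - (a / r)²) with ((r ^ 2 - a ^ 2) / r ^ 2) by (unfold Rsqr; field; lra).
      replace (r ^ 2 - a ^ 2) with (b ^ 2) by lra.
      replace (Rabs b / r * (Rabs b / r)) with ((Rabs b * Rabs b) / r ^ 2)
        by (field; lra).
      rewrite <- Rabs_mult, Rabs_pos_eq by nra. field. lra. }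
  rewrite Hsq in Hs. assert (Hb := acos_bound (a / r)). assert (HPI := PI_RGT_0).
  destruct (Rle_lt_dec 0 b) as [Hb0|Hb0].
  - exists (acos (a / r)). split; [lra|]. unfold cexp. cbn [fst snd].
    rewrite exp_ln, Hc, Hs by assumption. rewrite Rabs_pos_eq by assumption.
    f_equal; field; lra.
  - exists (2 * PI - acos (a / r)). split; [lra|]. unfold cexp. cbn [fst snd].
    rewrite exp_ln by assumption.
    rewrite cos_minus, sin_minus, cos_2PI, sin_2PI, Hc, Hs.
    rewrite Rabs_left by assumption. f_equal; field; lra.
Qed.

(** * Goursat's lemma and the mean value property *)

Lemma nested_intervals (u l : nat -> R) :
  (forall n, 0 <= l n) -> (forall n, u n <= u (S n)) ->
  (forall n, u (S n) + l (S n) <= u n + l n) ->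
  exists p, forall n, u n <= p <= u n + l n.
Proof.
  intros Hl Hu Hr.
  assert (Hinc : forall n m, (n <= m)%nat -> u n <= u m).
  { intros n m H. induction H as [|m H IH]; [lra|]. specialize (Hu m). lra. }
  assert (Hdec : forall n m, (n <= m)%nat -> u m + l m <= u n + l n).
  { intros n m H. induction H as [|m H IH]; [lra|]. specialize (Hr m). lra. }
  assert (Hub : forall n m, u m <= u n + l n).
  { intros n m. destruct (Nat.le_ge_cases n m) as [H|H].
    - specialize (Hdec n m H). specialize (Hl m). lra.
    - specialize (Hinc m n H). specialize (Hl n). lra. }
  destruct (completeness (fun y => exists n, y = u n)) as (p & Hp1 & Hp2).
  - exists (u 0%nat + l 0%nat). intros y (n & ->). apply Hub.
  - exists (u 0%nat), 0%nat. reflexivity.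
  - exists p. intros n. split.
    + apply Hp1. now exists n.
    + apply Hp2. intros y (m & ->). apply Hub.
Qed.

Lemma half_pow_small (K d : R) : 0 < d -> exists n, K * (/ 2) ^ n < d.
Proof.
  intros Hd. assert (HK : 0 < Rabs K + 1) by (assert (H := Rabs_pos K); lra).
  destruct (pow_lt_1_zero (/ 2)) with (y := d / (Rabs K + 1)) as (n & Hn).
  - rewrite Rabs_pos_eq; lra.
  - now apply Rdiv_lt_0_compat.
  - exists n. specialize (Hn n (Nat.le_refl n)).
    assert (Hp : 0 < (/ 2) ^ n) by (apply pow_lt; lra).
    rewrite Rabs_pos_eq in Hn by lra.
    apply (Rmult_lt_compat_r (Rabs K + 1)) in Hn; [|assumption].
    unfold Rdiv in Hn. rewrite (Rmult_assoc d), Rinv_l, Rmult_1_r in Hn by lra.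
    assert (H := Rle_abs K). nra.
Qed.

(** Allows [fst], [snd] and [Cmod] to be treated at once: continuity of [F] passes to [q] composed
    with [F]. *)
Definition nonexp (q : C -> R) : Prop :=
  forall z w : C, Rabs (q z - q w) <= Cmod (z - w).

Lemma nonexp_fst : nonexp fst.
Proof. intros z w. exact (proj1 (fst_snd_Cmod (z - w))). Qed.

Lemma nonexp_snd : nonexp snd.
Proof. intros z w. exact (proj2 (fst_snd_Cmod (z - w))). Qed.

Lemma nonexp_Cmod : nonexp Cmod.
Proof.
  intros z w. apply Rabs_le. assert (H1 := Cmod_triangle_rev z w).
  assert (H2 := Cmod_triangle_rev w z). rewrite Cmod_minus_sym in H2. lra.
Qed.

Lemma continuity_2d_of_ccont (q : C -> R) (F : C -> C) (x y : R) :
  nonexp q -> ccont F (x, y) -> continuity_2d_pt (fun s t => q (F (s, t))) x y.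
Proof.
  intros Hq HF eps. destruct (HF eps (cond_pos eps)) as (d & Hd & H).
  assert (Hd2 : 0 < d / 2) by lra. exists (mkposreal _ Hd2). cbn.
  intros s t Hs Ht. eapply Rle_lt_trans; [apply Hq|]. apply H.
  eapply Rle_lt_trans; [apply Cmod_le_sum|]. cbn. unfold Rminus in *. lra.
Qed.

Lemma continuous_horizontal (q : C -> R) (F : C -> C) (x y : R) :
  nonexp q -> ccont F (x, y) -> continuous (fun s => q (F (s, y))) x.
Proof.
  intros Hq HF. apply continuity_pt_filterlim.
  intros eps He. destruct (continuity_2d_of_ccont q F x y Hq HF (mkposreal eps He)) as (d & H).
  exists d. split; [apply cond_pos|]. intros s (_ & Hs). apply H; [exact Hs|].
  rewrite Rminus_diag, Rabs_R0. apply cond_pos.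
Qed.

Lemma continuous_vertical (q : C -> R) (F : C -> C) (x y : R) :
  nonexp q -> ccont F (x, y) -> continuous (fun t => q (F (x, t))) y.
Proof.
  intros Hq HF. apply continuity_pt_filterlim.
  intros eps He. destruct (continuity_2d_of_ccont q F x y Hq HF (mkposreal eps He)) as (d & H).
  exists d. split; [apply cond_pos|]. intros t (_ & Ht). apply H; [|exact Ht].
  rewrite Rminus_diag, Rabs_R0. apply cond_pos.
Qed.

Definition ccont_rect (F : C -> C) (a b c d : R) : Prop :=
  forall x y, a <= x <= b -> c <= y <= d -> ccont F (x, y).

Lemma ex_RInt_horizontal (q : C -> R) (F : C -> C) (a b c d y : R) :
  nonexp q -> a <= b -> c <= y <= d -> ccont_rect F a b c d ->
  ex_RInt (fun s => q (F (s, y))) a b.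
Proof.
  intros Hq Hab Hy HF. apply (@ex_RInt_continuous R_CompleteNormedModule).
  rewrite Rmin_left, Rmax_right by assumption. intros x Hx.
  apply continuous_horizontal; auto.
Qed.

Lemma ex_RInt_vertical (q : C -> R) (F : C -> C) (a b c d x : R) :
  nonexp q -> c <= d -> a <= x <= b -> ccont_rect F a b c d ->
  ex_RInt (fun t => q (F (x, t))) c d.
Proof.
  intros Hq Hcd Hx HF. apply (@ex_RInt_continuous R_CompleteNormedModule).
  rewrite Rmin_left, Rmax_right by assumption. intros y Hy.
  apply continuous_vertical; auto.
Qed.

(* The imaginary part of the integral of [F] around the rectangle
   [a, b] x [c, d]. *)
Definition rect_int (F : C -> C) (a b c d : R) : R :=
  RInt (fun x => snd (F (x, c))) a b - RInt (fun x => snd (F (x, d))) a b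
  + RInt (fun y => fst (F (b, y))) c d - RInt (fun y => fst (F (a, y))) c d.

Lemma rect_int_split_x (F : C -> C) (a m b c d : R) :
  a <= m <= b -> c <= d -> ccont_rect F a b c d ->
  rect_int F a b c d = rect_int F a m c d + rect_int F m b c d.
Proof.
  intros Hm Hcd HF. unfold rect_int.
  assert (H : forall y, c <= y <= d -> RInt (fun x => snd (F (x, y))) a b
    = RInt (fun x => snd (F (x, y))) a m + RInt (fun x => snd (F (x, y))) m b).
  { intros y Hy. symmetry.
    apply (RInt_Chasles (V := R_CompleteNormedModule) (fun x => snd (F (x, y)))).
    - apply (ex_RInt_horizontal snd F a m c d); auto using nonexp_snd; try lra.
      intros s t Hs Ht. apply HF; lra.
    - apply (ex_RInt_horizontal snd F m b c d); auto using nonexp_snd; try lra.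
      intros s t Hs Ht. apply HF; lra. }
  rewrite !H by lra. ring.
Qed.

Lemma rect_int_split_y (F : C -> C) (a b c m d : R) :
  c <= m <= d -> a <= b -> ccont_rect F a b c d ->
  rect_int F a b c d = rect_int F a b c m + rect_int F a b m d.
Proof.
  intros Hm Hab HF. unfold rect_int.
  assert (H : forall x, a <= x <= b -> RInt (fun y => fst (F (x, y))) c d
    = RInt (fun y => fst (F (x, y))) c m + RInt (fun y => fst (F (x, y))) m d).
  { intros x Hx. symmetry.
    apply (RInt_Chasles (V := R_CompleteNormedModule) (fun y => fst (F (x, y)))).
    - apply (ex_RInt_vertical fst F a b c m); auto using nonexp_fst; try lra.
      intros s t Hs Ht. apply HF; lra.
    - apply (ex_RInt_vertical fst F a b m d); auto using nonexp_fst; try lra.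
      intros s t Hs Ht. apply HF; lra. }
  rewrite !H by lra. ring.
Qed.

Lemma RInt_minus_const (f g : R -> R) (k a b : R) : ex_RInt f a b -> ex_RInt g a b ->
  RInt (fun t => f t - g t - k) a b = RInt f a b - RInt g a b - (b - a) * k.
Proof.
  intros Hf Hg. apply is_RInt_unique.
  apply (is_RInt_minus (V := R_NormedModule) (fun t => f t - g t) (fun _ => k) a b
    (RInt f a b - RInt g a b) ((b - a) * k)).
  - apply (is_RInt_minus (V := R_NormedModule) f g).
    + exact (RInt_correct (V := R_CompleteNormedModule) f a b Hf).
    + exact (RInt_correct (V := R_CompleteNormedModule) g a b Hg).
  - exact (is_RInt_const (V := R_NormedModule) a b k).
Qed.

(** The affine function [F p + l * (z - p)] has integral zero around the rectangle, so only the
    remainder contributes; it is at most [e] times the half perimeter at each point of the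
    boundary. *)
Lemma rect_int_le (F : C -> C) (a b c d : R) (p l : C) (e : R) :
  a <= b -> c <= d -> ccont_rect F a b c d ->
  a <= fst p <= b -> c <= snd p <= d -> 0 <= e ->
  (forall x y, a <= x <= b -> c <= y <= d ->
     Cmod (F (x, y) - F p - l * ((x, y) - p)) <= e * Cmod ((x, y) - p)) ->
  Rabs (rect_int F a b c d) <= 2 * e * ((b - a) + (d - c)) ^ 2.
Proof.
  intros Hab Hcd HF Hpx Hpy He Hl. set (s := (b - a) + (d - c)).
  assert (Herr : forall x y, a <= x <= b -> c <= y <= d ->
    Rabs (fst (F (x, y)) - fst (F p) - (fst l * (x - fst p) - snd l * (y - snd p))) <= e * s /\
    Rabs (snd (F (x, y)) - snd (F p) - (fst l * (y - snd p) + snd l * (x - fst p))) <= e * s).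
  { intros x y Hx Hy. specialize (Hl x y Hx Hy).
    assert (Hs : Cmod ((x, y) - p) <= s).
    { eapply Rle_trans; [apply Cmod_le_sum|]. unfold s.
      apply Rplus_le_compat; apply Rabs_le; cbn; lra. }
    assert (Hes : e * Cmod ((x, y) - p) <= e * s) by now apply Rmult_le_compat_l.
    destruct (fst_snd_Cmod (F (x, y) - F p - l * ((x, y) - p))) as [H1 H2].
    split.
    - eapply Rle_trans; [|apply Hes]. eapply Rle_trans; [|apply Hl].
      eapply Rle_trans; [|apply H1]. right. apply (f_equal Rabs). cbn. ring.
    - eapply Rle_trans; [|apply Hes]. eapply Rle_trans; [|apply Hl].
      eapply Rle_trans; [|apply H2]. right. apply (f_equal Rabs). cbn. ring. }
  (* Opposite sides are paired. The affine part then differs by a constant on each pair, and the two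
     constants subtracted here have opposite integrals. *)
  assert (E : rect_int F a b c d
    = RInt (fun x => snd (F (x, c)) - snd (F (x, d)) - fst l * (c - d)) a b
      + RInt (fun y => fst (F (b, y)) - fst (F (a, y)) - fst l * (b - a)) c d).
  { unfold rect_int. rewrite !RInt_minus_const; [ring| | | |].
    - apply (ex_RInt_vertical fst F a b c d); auto using nonexp_fst; lra.
    - apply (ex_RInt_vertical fst F a b c d); auto using nonexp_fst; lra.
    - apply (ex_RInt_horizontal snd F a b c d); auto using nonexp_snd; lra.
    - apply (ex_RInt_horizontal snd F a b c d); auto using nonexp_snd; lra. }
  rewrite E. eapply Rle_trans; [apply Rabs_triang|].
  assert (B1 : Rabs (RInt (fun x => snd (F (x, c)) - snd (F (x, d)) - fst l * (c - d)) a b)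
    <= (b - a) * (2 * (e * s))).
  { apply abs_RInt_le_const; [assumption| |].
    - apply (ex_RInt_minus (V := R_CompleteNormedModule)); [|apply ex_RInt_const].
      apply (ex_RInt_minus (V := R_CompleteNormedModule));
      apply (ex_RInt_horizontal snd F a b c d); auto using nonexp_snd; lra.
    - intros x Hx. destruct (Herr x c Hx ltac:(lra)) as [_ H1].
      destruct (Herr x d Hx ltac:(lra)) as [_ H2].
      apply Rabs_le_between in H1, H2. apply Rabs_le. lra. }
  assert (B2 : Rabs (RInt (fun y => fst (F (b, y)) - fst (F (a, y)) - fst l * (b - a)) c d)
    <= (d - c) * (2 * (e * s))).
  { apply abs_RInt_le_const; [assumption| |].
    - apply (ex_RInt_minus (V := R_CompleteNormedModule)); [|apply ex_RInt_const].
      apply (ex_RInt_minus (V := R_CompleteNormedModule));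
      apply (ex_RInt_vertical fst F a b c d); auto using nonexp_fst; lra.
    - intros y Hy. destruct (Herr b y ltac:(lra) Hy) as [H1 _].
      destruct (Herr a y ltac:(lra) Hy) as [H2 _].
      apply Rabs_le_between in H1, H2. apply Rabs_le. lra. }
  unfold s in *. nra.
Qed.

(* Goursat: if the integral were larger than [eta] times the area, bisection
   would propagate this to arbitrarily small rectangles around some point. *)
Lemma goursat (F : C -> C) (a b c d : R) :
  a < b -> c < d ->
  (forall x y, a <= x <= b -> c <= y <= d -> cdiff F (x, y)) ->
  rect_int F a b c d = 0.
Proof.
  intros Hab Hcd HF. destruct (Req_dec (rect_int F a b c d) 0) as [|Hne]; [assumption|].
  exfalso. set (w := b - a). set (h := d - c).
  assert (Hw : 0 < w) by (unfold w; lra). assert (Hh : 0 < h) by (unfold h; lra).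
  assert (Hwh : 0 < w * h) by now apply Rmult_lt_0_compat.
  set (J := fun (p : R * R) w h => Rabs (rect_int F (fst p) (fst p + w) (snd p) (snd p + h))).
  (* The factor 2 makes the inequality [bad] strict for the initial rectangle. *)
  set (eta := Rabs (rect_int F a b c d) / (2 * (w * h))).
  assert (Hpos := Rabs_pos_lt _ Hne).
  assert (Heta : 0 < eta) by (apply Rdiv_lt_0_compat; lra).
  set (k := fun n => (/ 2) ^ n).
  assert (Hk : forall n, 0 < k n) by (intros n; apply pow_lt; lra).
  assert (HkS : forall n, k (S n) = k n / 2) by (intros n; unfold k; cbn; field).
  set (bad := fun n p => eta * (w * k n * (h * k n)) < J p (w * k n) (h * k n)).
  (* Takes the first bad quarter, with the last quarter as default; the default is bad as well,
     since four good quarters would make the whole rectangle good. *)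
  set (next := fun n (p : R * R) =>
    let x' := fst p + w * k (S n) in let y' := snd p + h * k (S n) in
    if Rlt_dec (eta * (w * k (S n) * (h * k (S n)))) (J p (w * k (S n)) (h * k (S n))) then p
    else if Rlt_dec (eta * (w * k (S n) * (h * k (S n))))
              (J (x', snd p) (w * k (S n)) (h * k (S n))) then (x', snd p)
    else if Rlt_dec (eta * (w * k (S n) * (h * k (S n))))
              (J (fst p, y') (w * k (S n)) (h * k (S n))) then (fst p, y')
    else (x', y')).
  set (P := fix P n := match n with O => (a, c) | S m => next m (P m) end).
  assert (HP : forall n, fst (P n) <= fst (P (S n))
     /\ fst (P (S n)) + w * k (S n) <= fst (P n) + w * k n
     /\ snd (P n) <= snd (P (S n))
     /\ snd (P (S n)) + h * k (S n) <= snd (P n) + h * k n).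
  { intros n. change (P (S n)) with (next n (P n)). unfold next. rewrite HkS.
    assert (0 < w * k n) by now apply Rmult_lt_0_compat.
    assert (0 < h * k n) by now apply Rmult_lt_0_compat.
    repeat destruct (Rlt_dec _ _); cbn [fst snd]; lra. }
  assert (Hin : forall n, a <= fst (P n) /\ fst (P n) + w * k n <= b
     /\ c <= snd (P n) /\ snd (P n) + h * k n <= d).
  { induction n as [|n IH].
    - cbn. unfold w, h. lra.
    - specialize (HP n). lra. }
  assert (Hbad : forall n, bad n (P n)).
  { induction n as [|n IH].
    - unfold bad, J, k. cbn [P fst snd pow]. rewrite !Rmult_1_r.
      replace (a + w) with b by (unfold w; ring). replace (c + h) with d by (unfold h; ring).
      unfold eta. replace (Rabs (rect_int F a b c d) / (2 * (w * h)) * (w * h))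
        with (Rabs (rect_int F a b c d) / 2) by (field; lra). lra.
    - destruct (Hin n) as (I1 & I2 & I3 & I4). unfold bad in *.
      change (P (S n)) with (next n (P n)). unfold next.
      destruct (Rlt_dec _ _) as [?|N1]; [assumption|].
      destruct (Rlt_dec _ _) as [?|N2]; [assumption|].
      destruct (Rlt_dec _ _) as [?|N3]; [assumption|].
      destruct (Rlt_dec (eta * (w * k (S n) * (h * k (S n))))
        (J (fst (P n) + w * k (S n), snd (P n) + h * k (S n)) (w * k (S n)) (h * k (S n))))
        as [?|N4]; [assumption|]. exfalso.
      apply Rnot_lt_le in N1, N2, N3, N4. unfold J in *. cbn [fst snd] in *.
      destruct (P n) as [x y]. cbn [fst snd] in *.
      assert (HW : w * k n = w * k (S n) + w * k (S n)) by (rewrite HkS; field).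
      assert (HH : h * k n = h * k (S n) + h * k (S n)) by (rewrite HkS; field).
      assert (0 < w * k (S n)) by now apply Rmult_lt_0_compat.
      assert (0 < h * k (S n)) by now apply Rmult_lt_0_compat.
      rewrite HW, HH in *.
      set (W := w * k (S n)) in *. set (H' := h * k (S n)) in *.
      assert (HC : ccont_rect F x (x + (W + W)) y (y + (H' + H'))).
      { intros s t Hs Ht. apply cdiff_ccont, HF; lra. }
      rewrite (rect_int_split_x F x (x + W)) in IH by (auto; lra).
      rewrite (rect_int_split_y F x (x + W) y (y + H')) in IH;
        [|lra|lra|intros s t Hs Ht; apply HC; lra].
      rewrite (rect_int_split_y F (x + W) (x + (W + W)) y (y + H')) in IH;
        [|lra|lra|intros s t Hs Ht; apply HC; lra].
      replace (x + (W + W)) with (x + W + W) in IH by ring.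
      replace (y + (H' + H')) with (y + H' + H') in IH by ring.
      match type of IH with _ < Rabs (?A + ?B + (?C + ?D)) =>
        assert (T1 := Rabs_triang (A + B) (C + D));
        assert (T2 := Rabs_triang A B); assert (T3 := Rabs_triang C D) end.
      lra. }
  destruct (nested_intervals (fun n => fst (P n)) (fun n => w * k n)) as (px & Hpx).
  { intros n. left. now apply Rmult_lt_0_compat. }
  { intros n. apply HP. } { intros n. apply HP. }
  destruct (nested_intervals (fun n => snd (P n)) (fun n => h * k n)) as (py & Hpy).
  { intros n. left. now apply Rmult_lt_0_compat. }
  { intros n. apply HP. } { intros n. apply HP. }
  destruct (Hin 0%nat) as (I1 & I2 & I3 & I4).
  specialize (Hpx 0%nat) as Hpx0. specialize (Hpy 0%nat) as Hpy0.
  destruct (cdiff_elim F (px, py)) as (l & Hl).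
  { apply HF; lra. }
  (* Chosen so that the bound of [rect_int_le] for the n-th rectangle is exactly [eta] times its
     area. *)
  set (e := eta * (w * h) / (2 * (w + h) ^ 2)).
  assert (Hs2 : 0 < (w + h) ^ 2) by (apply pow_lt; lra).
  assert (He : 0 < e).
  { apply Rdiv_lt_0_compat; [now apply Rmult_lt_0_compat|lra]. }
  destruct (Hl e He) as (dl & Hdl & Hd).
  destruct (half_pow_small (w + h) dl Hdl) as (n & Hn). fold (k n) in Hn.
  specialize (Hbad n). destruct (Hin n) as (K1 & K2 & K3 & K4).
  specialize (Hpx n). specialize (Hpy n). cbv beta in Hpx, Hpy.
  unfold bad, J in Hbad.
  assert (HB := rect_int_le F (fst (P n)) (fst (P n) + w * k n) (snd (P n))
    (snd (P n) + h * k n) (px, py) l e).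
  assert (0 < w * k n) by now apply Rmult_lt_0_compat.
  assert (0 < h * k n) by now apply Rmult_lt_0_compat.
  cbn [fst snd] in HB.
  assert (HB' : Rabs (rect_int F (fst (P n)) (fst (P n) + w * k n) (snd (P n))
    (snd (P n) + h * k n)) <= 2 * e * ((w + h) * k n) ^ 2).
  { replace ((w + h) * k n) with ((fst (P n) + w * k n - fst (P n))
      + (snd (P n) + h * k n - snd (P n))) by ring.
    apply HB; try lra.
    - intros s t Hs Ht. apply cdiff_ccont, HF; lra.
    - intros s t Hs Ht. apply Hd.
      eapply Rle_lt_trans; [apply Cmod_le_sum|]. cbn [fst snd Cminus Cplus Copp].
      apply Rle_lt_trans with (w * k n + h * k n); [|lra].
      apply Rplus_le_compat; apply Rabs_le; lra. }
  apply (Rlt_not_le _ _ Hbad). eapply Rle_trans; [apply HB'|]. right.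
  unfold e. field. lra.
Qed.

Lemma exp_le_compat (x y : R) : x <= y -> exp x <= exp y.
Proof. intros [H| ->]; [left; now apply exp_increasing|lra]. Qed.

Lemma Rabs_RInt_close (g : R -> R) (a b v e : R) : a <= b ->
  ex_RInt g a b -> (forall t, a <= t <= b -> Rabs (g t - v) <= e) ->
  Rabs (RInt g a b - (b - a) * v) <= (b - a) * e.
Proof.
  intros Hab Hg H.
  replace (RInt g a b - (b - a) * v) with (RInt (fun t => g t - v) a b).
  - apply abs_RInt_le_const; auto.
    apply (ex_RInt_minus (V := R_CompleteNormedModule)); [assumption|apply ex_RInt_const].
  - rewrite (RInt_minus (V := R_CompleteNormedModule) g (fun _ => v));
      [|assumption|apply ex_RInt_const].
    rewrite RInt_const. reflexivity.
Qed.

Definition diff_disc (f : C -> C) (c : C) (r : R) : Prop :=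
  forall z, Cmod (z - c) <= r -> cdiff f z.

(* Goursat's lemma for [f (c + exp w)], whose horizontal sides cancel, shows that
   the mean over the circle of radius [r] does not depend on [r]. *)
Lemma mean_value (f : C -> C) (c : C) (r : R) : 0 < r -> diff_disc f c r ->
  RInt (fun t => fst (f (c + cexp (ln r, t))%C)) 0 (2 * PI) = 2 * PI * fst (f c).
Proof.
  intros Hr Hf. assert (HPI := PI_RGT_0).
  set (F := fun w => f (c + cexp w)%C).
  assert (HF : forall x y, x <= ln r -> cdiff F (x, y)).
  { intros x y Hx. apply (cdiff_comp f (fun w => c + cexp w)%C).
    - apply cdiff_plus; [apply cdiff_const|apply cdiff_cexp].
    - apply Hf. replace (c + cexp (x, y) - c)%C with (cexp (x, y)) by ring.
      rewrite Cmod_cexp. cbn [fst]. rewrite <- (exp_ln r) by assumption.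
      now apply exp_le_compat. }
  assert (Hconst : forall x, x < ln r ->
    RInt (fun t => fst (F (ln r, t))) 0 (2 * PI) = RInt (fun t => fst (F (x, t))) 0 (2 * PI)).
  { intros x Hx. assert (G := goursat F x (ln r) 0 (2 * PI) Hx ltac:(lra)).
    unfold rect_int in G.
    rewrite (RInt_ext (fun s => snd (F (s, 2 * PI))) (fun s => snd (F (s, 0)))) in G.
    - enough (H : RInt (fun s => snd (F (s, 0))) x (ln r) - RInt (fun s => snd (F (s, 0))) x (ln r)
        + RInt (fun t => fst (F (ln r, t))) 0 (2 * PI)
        - RInt (fun t => fst (F (x, t))) 0 (2 * PI) = 0) by lra.
      apply G. intros s t Hs _. apply HF; lra.
    - intros s _. unfold F. replace (2 * PI) with (0 + 2 * PI) by ring.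
      now rewrite cexp_shift. }
  apply cond_eq. intros eps He.
  assert (Hc : ccont f c).
  { apply cdiff_ccont, Hf. replace (c - c)%C with (RtoC 0) by ring. rewrite Cmod_0. lra. }
  destruct (Hc (eps / (4 * PI))) as (d & Hd & Hcd).
  { apply Rdiv_lt_0_compat; lra. }
  (* Since the mean does not depend on the radius, the circle is shrunk until [f] is close to [f c]
     on it. *)
  set (x := ln (Rmin r d / 2)).
  assert (Hm : 0 < Rmin r d) by now apply Rmin_pos.
  assert (Hml := Rmin_l r d). assert (Hmr := Rmin_r r d).
  assert (Hx : x < ln r) by (apply ln_increasing; lra).
  change (Rabs (RInt (fun t => fst (F (ln r, t))) 0 (2 * PI) - 2 * PI * fst (f c)) < eps).
  rewrite (Hconst x Hx).
  replace (2 * PI * fst (f c)) with ((2 * PI - 0) * fst (f c)) by ring.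
  eapply Rle_lt_trans.
  - apply Rabs_RInt_close with (e := eps / (4 * PI)); [lra| |].
    + apply (ex_RInt_vertical fst F x (ln r) 0 (2 * PI)); auto using nonexp_fst; try lra.
      intros s t Hs Ht. apply cdiff_ccont, HF; lra.
    + intros t Ht. left. eapply Rle_lt_trans; [apply nonexp_fst|]. apply Hcd.
      replace (c + cexp (x, t) - c)%C with (cexp (x, t)) by ring.
      rewrite Cmod_cexp. unfold x. cbn [fst]. rewrite exp_ln by lra. lra.
  - replace ((2 * PI - 0) * (eps / (4 * PI))) with (eps / 2) by (field; lra). lra.
Qed.

Lemma circle_point_dist (c : C) (r t : R) : 0 < r ->
  Cmod ((c + cexp (ln r, t)) - c) = r.
Proof.
  intros Hr. replace (c + cexp (ln r, t) - c)%C with (cexp (ln r, t)) by ring.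
  rewrite Cmod_cexp. now apply exp_ln.
Qed.

Lemma continuous_on_circle (q : C -> R) (f : C -> C) (c : C) (r : R) :
  nonexp q -> 0 < r -> (forall z, Cmod (z - c) = r -> ccont f z) ->
  forall t, continuous (fun t => q (f (c + cexp (ln r, t))%C)) t.
Proof.
  intros Hq Hr Hf t. apply (continuous_vertical q (fun w => f (c + cexp w)%C)); [assumption|].
  apply (ccont_comp f (fun w => c + cexp w)%C).
  - apply ccont_plus; [apply ccont_const|apply cdiff_ccont, cdiff_cexp].
  - apply Hf. now apply circle_point_dist.
Qed.

(** This is the Euclidean inner product. Taking [v = f c] turns statements about [|f|] into
    statements about the real part of the function [Cconj v * f], to which [mean_value] applies. *)
Lemma fst_conj_mult (v z : C) : fst (Cconj v * z)%C = fst v * fst z + snd v * snd z.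
Proof. cbn. ring. Qed.

Lemma fst_conj_mult_le (v z : C) : fst (Cconj v * z)%C <= Cmod v * Cmod z.
Proof.
  rewrite <- (Cmod_conj v), <- Cmod_mult.
  eapply Rle_trans; [apply Rle_abs|apply fst_snd_Cmod].
Qed.

Lemma fst_conj_self (v : C) : fst (Cconj v * v)%C = Cmod v * Cmod v.
Proof.
  rewrite fst_conj_mult. assert (H := Cmod2_alt v). unfold Re, Im in H. lra.
Qed.

Lemma diff_disc_conj_mult (f : C -> C) (v c : C) (r : R) :
  diff_disc f c r -> diff_disc (fun z => Cconj v * f z)%C c r.
Proof. intros Hf z Hz. apply cdiff_mult; [apply cdiff_const|now apply Hf]. Qed.

Lemma circle_point (c z : C) (r : R) : 0 < r -> Cmod (z - c) = r ->
  exists t, 0 <= t <= 2 * PI /\ z = (c + cexp (ln r, t))%C.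
Proof.
  intros Hr Hz. destruct (polar_form (z - c)) as (t & Ht & E).
  - apply Cmod_gt_0. lra.
  - exists t. split; [assumption|]. rewrite <- Hz, <- E. ring.
Qed.

(** The mean of the real part of [Cconj (f c) * f] over the circle is [|f c| ^ 2], and it is at most
    [|f c| * K]. *)
Lemma max_disc_center (f : C -> C) (c : C) (r K : R) : 0 < r -> diff_disc f c r ->
  (forall z, Cmod (z - c) = r -> Cmod (f z) <= K) -> Cmod (f c) <= K.
Proof.
  intros Hr Hf HK. assert (HPI := PI_RGT_0).
  assert (H := mean_value _ c r Hr (diff_disc_conj_mult f (f c) c r Hf)).
  cbv beta in H. rewrite fst_conj_self in H.
  assert (Hle : RInt (fun t => fst (Cconj (f c) * f (c + cexp (ln r, t)))%C) 0 (2 * PI)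
    <= RInt (fun _ => Cmod (f c) * K) 0 (2 * PI)).
  { apply RInt_le; [lra| |apply ex_RInt_const|].
    - apply (@ex_RInt_continuous R_CompleteNormedModule). intros t _.
      apply (continuous_on_circle fst (fun z => Cconj (f c) * f z)%C);
        auto using nonexp_fst.
      intros z Hz. apply cdiff_ccont, (diff_disc_conj_mult f (f c) c r Hf). lra.
    - intros t _. eapply Rle_trans; [apply fst_conj_mult_le|].
      apply Rmult_le_compat_l; [apply Cmod_ge_0|]. apply HK.
      now apply circle_point_dist. }
  rewrite H, RInt_const in Hle. unfold scal in Hle; cbn in Hle. unfold mult in Hle; cbn in Hle.
  assert (H0 := Cmod_ge_0 (f c)). destruct H0 as [H0|H0].
  - apply Rmult_le_reg_l with (2 * PI * Cmod (f c)); [|lra].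
    apply Rmult_lt_0_compat; lra.
  - rewrite <- H0. eapply Rle_trans; [apply Cmod_ge_0|].
    apply (HK (c + cexp (ln r, 0))%C). now apply circle_point_dist.
Qed.

Lemma RInt_zero_nonneg (g : R -> R) (a b : R) : a < b ->
  (forall t, continuous g t) -> (forall t, 0 <= g t) -> RInt g a b = 0 ->
  forall t, a <= t <= b -> g t = 0.
Proof.
  intros Hab Hc Hg HI t Ht. destruct (Hg t) as [Hpos|]; [|auto]. exfalso.
  assert (Hct := Hc t). apply continuity_pt_filterlim in Hct.
  destruct (Hct (g t) Hpos) as (d & Hd & H).
  set (u := Rmax a (t - d / 2)). set (v := Rmin b (t + d / 2)).
  assert (Hu : a <= u <= t /\ t - d / 2 <= u).
  { unfold u. repeat split; auto using Rmax_l, Rmax_r. apply Rmax_lub; lra. }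
  assert (Hv : t <= v <= b /\ v <= t + d / 2).
  { unfold v. repeat split; auto using Rmin_l, Rmin_r. apply Rmin_glb; lra. }
  assert (Huv : u < v).
  { unfold u, v. apply Rmax_lub_lt; apply Rmin_glb_lt; lra. }
  assert (Hex : forall p q, ex_RInt g p q).
  { intros p q. apply (@ex_RInt_continuous R_CompleteNormedModule). auto. }
  assert (H1 : 0 < RInt g u v).
  { apply RInt_gt_0; auto. intros x Hx. destruct (Req_dec t x) as [<-|Hne]; [assumption|].
    specialize (H x). cbn in H. unfold Rdist in H.
    assert (HH : Rabs (g x - g t) < g t).
    { apply H. split; [split; [exact I|assumption]|]. apply Rabs_def1; lra. }
    apply Rabs_def2 in HH. lra. }
  assert (H2 := RInt_ge_0 g a u ltac:(lra) (Hex _ _) ltac:(auto)).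
  assert (H3 := RInt_ge_0 g v b ltac:(lra) (Hex _ _) ltac:(auto)).
  assert (C1 : RInt g a u + RInt g u v = RInt g a v)
    by exact (RInt_Chasles (V := R_CompleteNormedModule) g a u v (Hex _ _) (Hex _ _)).
  assert (C2 : RInt g a v + RInt g v b = RInt g a b)
    by exact (RInt_Chasles (V := R_CompleteNormedModule) g a v b (Hex _ _) (Hex _ _)).
  lra.
Qed.

(** Equality case: with [v = f c], the function [|v| ^ 2] minus the real part of [Cconj v * f] is
    nonnegative on the circle and has mean zero, so it vanishes there. Together with [|f| <= |v|]
    this leaves [|f - v| ^ 2 <= 0]. *)
Lemma mean_eq (f : C -> C) (c : C) (r : R) : 0 < r -> diff_disc f c r ->
  (forall z, Cmod (z - c) = r -> Cmod (f z) <= Cmod (f c)) ->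
  forall z, Cmod (z - c) = r -> f z = f c.
Proof.
  intros Hr Hf HK z Hz. assert (HPI := PI_RGT_0).
  set (v := f c). set (h := fun z => (Cconj v * f z)%C).
  assert (Hh : diff_disc h c r) by now apply diff_disc_conj_mult.
  assert (H := mean_value h c r Hr Hh).
  assert (Ev : fst (h c) = Cmod v * Cmod v) by apply fst_conj_self. rewrite Ev in H.
  assert (Hcont : forall t, continuous (fun t => fst (h (c + cexp (ln r, t))%C)) t).
  { apply continuous_on_circle; auto using nonexp_fst. intros y Hy. apply cdiff_ccont, Hh. lra. }
  destruct (circle_point c z r Hr Hz) as (t & Ht & ->).
  assert (Hz0 : Cmod v * Cmod v - fst (h (c + cexp (ln r, t))%C) = 0).
  { apply (RInt_zero_nonneg
      (fun t => Cmod v * Cmod v - fst (h (c + cexp (ln r, t))%C)) 0 (2 * PI)); [lra| | | |assumption].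
    - intros s. apply (continuous_minus (V := R_NormedModule)); [apply continuous_const|apply Hcont].
    - intros s. assert (Hle := fst_conj_mult_le v (f (c + cexp (ln r, s))%C)).
      specialize (HK (c + cexp (ln r, s))%C (circle_point_dist c r s Hr)).
      assert (H0 := Cmod_ge_0 v). fold v in HK. unfold h.
      assert (Cmod v * Cmod (f (c + cexp (ln r, s))%C) <= Cmod v * Cmod v)
        by now apply Rmult_le_compat_l.
      lra.
    - rewrite (RInt_minus (V := R_CompleteNormedModule) (fun _ => Cmod v * Cmod v)
        (fun t => fst (h (c + cexp (ln r, t))%C))).
      + rewrite RInt_const, H. unfold minus, plus, opp, scal; cbn. unfold mult; cbn. ring.
      + apply ex_RInt_const.
      + apply (@ex_RInt_continuous R_CompleteNormedModule). auto. }
  specialize (HK _ Hz). fold v in HK. set (u := f (c + cexp (ln r, t))%C) in *.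
  unfold h in Hz0. fold u in Hz0. rewrite fst_conj_mult in Hz0.
  assert (E1 := Cmod2_alt v). assert (E2 := Cmod2_alt u). assert (E3 := Cmod2_alt (u - v)).
  unfold Re, Im in E1, E2, E3. cbn [fst snd Cminus Cplus Copp] in E3.
  assert (H0 := Cmod_ge_0 u).
  assert (Hu2 : Cmod u ^ 2 <= Cmod v ^ 2) by (apply pow_incr; lra).
  assert (Hn := Cmod_ge_0 (u - v)).
  apply Ceq_minus, Cmod_eq_0. nra.
Qed.

(** * Maximum principles *)

Lemma cdiff_minus (f g : C -> C) (z : C) :
  cdiff f z -> cdiff g z -> cdiff (fun w => f w - g w)%C z.
Proof.
  intros Hf Hg. apply (cdiff_ext (fun w => f w + (- (1)) * g w)%C).
  - intros w. ring.
  - apply cdiff_plus; [assumption|]. apply cdiff_mult; [apply cdiff_const|assumption].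
Qed.

(** Reduced to the one-variable theorem twice: a maximiser in [y] is chosen for each [x], and the
    maximal value is continuous in [x] by uniform continuity. *)
Lemma rect_max (f : R -> R -> R) (a b c d : R) : a <= b -> c <= d ->
  (forall x y, a <= x <= b -> c <= y <= d -> continuity_2d_pt f x y) ->
  exists x0 y0, a <= x0 <= b /\ c <= y0 <= d /\
    forall x y, a <= x <= b -> c <= y <= d -> f x y <= f x0 y0.
Proof.
  (* Clamping to [[a, b]] extends the partial maximum to all of R, so that it is continuous from
     both sides at [a] and [b] too. *)
  intros Hab Hcd Hf. set (cl := fun x => Rmax a (Rmin b x)).
  assert (Hcl : forall x, a <= cl x <= b).
  { intros x. unfold cl. split; [apply Rmax_l|]. apply Rmax_lub; [assumption|apply Rmin_l]. }
  assert (Hid : forall x, a <= x <= b -> cl x = x).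
  { intros x Hx. unfold cl. rewrite Rmin_right, Rmax_right; lra. }
  assert (Hlip : forall x y, Rabs (cl x - cl y) <= Rabs (x - y)).
  { intros x y. unfold cl, Rmax, Rmin, Rabs.
    repeat (destruct (Rle_dec _ _) || destruct (Rcase_abs _)); lra. }
  assert (HY : forall x, {y | c <= y <= d /\ forall t, c <= t <= d -> f (cl x) t <= f (cl x) y}).
  { intros x. apply constructive_indefinite_description.
    destruct (continuity_ab_maj (f (cl x)) c d Hcd) as (y & H1 & H2).
    - intros y Hy eps He. destruct (Hf (cl x) y (Hcl x) Hy (mkposreal eps He)) as (e & H).
      exists e. split; [apply cond_pos|]. intros t (_ & Ht). apply H; [|exact Ht].
      rewrite Rminus_diag, Rabs_R0. apply cond_pos.
    - exists y. auto. }
  set (Y := fun x => proj1_sig (HY x)).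
  assert (HY1 : forall x, c <= Y x <= d) by (intros x; apply (proj2_sig (HY x))).
  assert (HY2 : forall x t, c <= t <= d -> f (cl x) t <= f (cl x) (Y x))
    by (intros x; apply (proj2_sig (HY x))).
  destruct (continuity_ab_maj (fun x => f (cl x) (Y x)) a b Hab) as (x0 & H1 & H2).
  - intros x Hx eps He.
    destruct (uniform_continuity_2d f a b c d Hf (mkposreal eps He)) as (e & H).
    exists e. split; [apply cond_pos|]. intros s (_ & Hs). cbn in Hs |- *. unfold Rdist in *.
    assert (Hs1 : Rabs (cl s - cl x) < e) by (eapply Rle_lt_trans; [apply Hlip|exact Hs]).
    assert (H0 : forall y, Rabs (y - y) < e).
    { intros y. rewrite Rminus_diag, Rabs_R0. apply cond_pos. }
    assert (A1 := H (cl x) (Y s) (cl s) (Y s) (Hcl _) (HY1 _) (Hcl _) (HY1 _) Hs1 (H0 _)).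
    assert (A2 := H (cl x) (Y x) (cl s) (Y x) (Hcl _) (HY1 _) (Hcl _) (HY1 _) Hs1 (H0 _)).
    assert (B1 := HY2 x (Y s) (HY1 s)). assert (B2 := HY2 s (Y x) (HY1 x)).
    cbn in A1, A2. apply Rabs_def2 in A1, A2. apply Rabs_def1; lra.
  - exists x0, (Y x0). split; [assumption|]. split; [apply HY1|]. intros x y Hx Hy.
    specialize (H1 x Hx). rewrite !Hid in H1 by assumption.
    assert (H3 := HY2 x y Hy). rewrite Hid in H3 by assumption. lra.
Qed.

(** In logarithmic coordinates the annulus is a rectangle. The radial weight [k] is left free: it is
    later a Gaussian factor, the constant 1, and a power of the logarithmic distance to the outer
    circle. *)
Lemma annulus_weighted_max (f : C -> C) (k : R -> R) (a b : R) : 0 < a <= b ->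
  (forall z, a <= Cmod z <= b -> ccont f z) ->
  (forall x, ln a <= x <= ln b -> continuity_pt k x) ->
  exists z0, a <= Cmod z0 <= b /\ forall z, a <= Cmod z <= b ->
    Cmod (f z) * k (ln (Cmod z)) <= Cmod (f z0) * k (ln (Cmod z0)).
Proof.
  intros [Ha Hab] Hf Hk. assert (HPI := PI_RGT_0).
  assert (Hl : ln a <= ln b) by now apply ln_le.
  assert (Hmod : forall x y, ln a <= x <= ln b -> a <= Cmod (cexp (x, y)) <= b).
  { intros x y Hx. rewrite Cmod_cexp. cbn.
    rewrite <- (exp_ln a) by assumption. rewrite <- (exp_ln b) by lra.
    split; apply exp_le_compat; lra. }
  destruct (rect_max (fun x y => Cmod (f (cexp (x, y))) * k x) (ln a) (ln b) 0 (2 * PI))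
    as (x0 & y0 & Hx0 & Hy0 & H); [assumption|lra| |].
  - intros x y Hx Hy. apply continuity_2d_pt_mult.
    + apply (continuity_2d_of_ccont Cmod (fun w => f (cexp w))); [apply nonexp_Cmod|].
      apply (ccont_comp f cexp); [apply cdiff_ccont, cdiff_cexp|]. now apply Hf, Hmod.
    + apply (continuity_1d_2d_pt_comp k (fun x _ => x)); [now apply Hk|].
      apply continuity_2d_pt_id1.
  - exists (cexp (x0, y0)). split; [now apply Hmod|]. intros z Hz.
    destruct (polar_form z) as (y & Hy & E). { apply Cmod_gt_0. lra. }
    rewrite (Cmod_cexp (x0, y0)). cbn [fst]. rewrite ln_exp.
    rewrite E at 1. apply H; [|assumption]. split; apply ln_le; lra.
Qed.

Lemma Cmod_cexp_scale (z s : C) : Cmod (z * cexp s) = Cmod z * exp (fst s).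
Proof. now rewrite Cmod_mult, Cmod_cexp. Qed.

Lemma fst_R_mult (r : R) (z : C) : fst (r * z)%C = r * fst z.
Proof. cbn. ring. Qed.

Lemma Cmult_cexp_0_r (z : C) : (z * cexp 0)%C = z.
Proof. rewrite cexp_0. ring. Qed.

Lemma cdiff_linear (c z : C) : cdiff (fun w => c * w)%C z.
Proof. apply cdiff_mult; [apply cdiff_const|apply cdiff_id]. Qed.

Lemma cdiff_cexp_linear (c z : C) : cdiff (fun w => cexp (c * w))%C z.
Proof. apply (cdiff_comp cexp (fun w => c * w)%C); [apply cdiff_linear|apply cdiff_cexp]. Qed.

Lemma cdiff_scale_cexp (f : C -> C) (z s : C) :
  cdiff f (z * cexp s)%C -> cdiff (fun s => f (z * cexp s)%C) s.
Proof.
  intros H. apply (cdiff_comp f (fun s => z * cexp s)%C); [|assumption].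
  apply cdiff_mult; [apply cdiff_const|apply cdiff_cexp].
Qed.

(* Multiplying by [exp (eta * (ln |z| - ln a) ^ 2)] makes [|f z| |z|^-al] strictly
   subharmonic in the radial direction, which excludes interior maxima. *)
Lemma annulus_max (f : C -> C) (a b al K : R) : 0 < a < b ->
  (forall z, a <= Cmod z <= b -> cdiff f z) ->
  (forall z, Cmod z = a \/ Cmod z = b -> Cmod (f z) <= K * Rpower (Cmod z) al) ->
  forall z, a <= Cmod z <= b -> Cmod (f z) <= K * Rpower (Cmod z) al.
Proof.
  intros [Ha Hab] Hf HK z1 Hz1.
  destruct (Rle_lt_dec (Cmod (f z1)) (K * Rpower (Cmod z1) al)) as [|Hlt]; [assumption|].
  exfalso. unfold Rpower in *.
  assert (HK0 : 0 <= K).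
  { assert (H := HK (RtoC a)). rewrite Cmod_R, Rabs_pos_eq in H by lra.
    specialize (H (or_introl eq_refl)). assert (H0 := Cmod_ge_0 (f a)).
    assert (He := exp_pos (al * ln a)). nra. }
  set (la := ln a). set (L := ln b - la).
  assert (HL : 0 < L) by (unfold L, la; assert (H := ln_increasing a b Ha Hab); lra).
  set (v1 := Cmod (f z1) * exp (- al * ln (Cmod z1))).
  assert (Hv1 : K < v1).
  { apply (Rmult_lt_compat_r (exp (- al * ln (Cmod z1)))) in Hlt; [|apply exp_pos].
    rewrite Rmult_assoc, <- exp_plus in Hlt.
    replace (al * ln (Cmod z1) + - al * ln (Cmod z1)) with 0 in Hlt by ring.
    rewrite exp_0, Rmult_1_r in Hlt. exact Hlt. }
  (* Strictly between [K] and [v1], hence positive even if [K = 0], so that [v1 / Kp] makes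
     sense. *)
  set (Kp := (K + v1) / 2).
  assert (HKp : 0 < Kp /\ K < Kp < v1) by (unfold Kp; lra).
  assert (Hq : 1 < v1 / Kp).
  { apply Rmult_lt_reg_r with Kp; [lra|]. unfold Rdiv. rewrite Rmult_assoc, Rinv_l; lra. }
  (* Then [exp (eta * L ^ 2)] is the square root of [v1 / Kp]: the added factor cannot lift the
     boundary values up to [v1], so the maximum is interior. *)
  set (eta := ln (v1 / Kp) / (2 * L ^ 2)).
  assert (HL2 : 0 < L ^ 2) by now apply pow_lt.
  assert (Hlnq : 0 < ln (v1 / Kp)) by (rewrite <- ln_1; apply ln_increasing; lra).
  assert (Heta : 0 < eta) by (apply Rdiv_lt_0_compat; lra).
  assert (HbL : K * exp (eta * L ^ 2) < v1).
  { apply Rle_lt_trans with (K * (v1 / Kp)).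
    - apply Rmult_le_compat_l; [assumption|]. rewrite <- (exp_ln (v1 / Kp)) by lra.
      apply exp_le_compat. unfold eta.
      replace (ln (v1 / Kp) / (2 * L ^ 2) * L ^ 2) with (ln (v1 / Kp) / 2) by (field; lra). lra.
    - replace (K * (v1 / Kp)) with (K / Kp * v1) by (field; lra).
      assert (K / Kp < 1).
      { apply Rmult_lt_reg_r with Kp; [lra|]. unfold Rdiv. rewrite Rmult_assoc, Rinv_l; lra. }
      nra. }
  set (k := fun x => exp (- al * x + eta * (x - la) ^ 2)).
  destruct (annulus_weighted_max f k a b) as (z0 & Hz0 & Hmax).
  { lra. } { intros z Hz. now apply cdiff_ccont, Hf. }
  { intros x _. apply derivable_continuous_pt, ex_derive_Reals_0. unfold k. auto_derive. auto. }
  assert (Hval : v1 <= Cmod (f z0) * k (ln (Cmod z0))).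
  { eapply Rle_trans; [|apply (Hmax z1 Hz1)]. unfold v1.
    apply Rmult_le_compat_l; [apply Cmod_ge_0|]. apply exp_le_compat.
    assert (H := pow2_ge_0 (ln (Cmod z1) - la)). nra. }
  assert (Hedge : forall z, Cmod z = a \/ Cmod z = b ->
    Cmod (f z) * k (ln (Cmod z)) <= K * exp (eta * (ln (Cmod z) - la) ^ 2)).
  { intros z Hz. specialize (HK z Hz). unfold k. rewrite exp_plus, <- Rmult_assoc.
    apply Rmult_le_compat_r; [left; apply exp_pos|].
    apply (Rmult_le_compat_r (exp (- al * ln (Cmod z)))) in HK; [|left; apply exp_pos].
    rewrite (Rmult_assoc K), <- exp_plus in HK.
    replace (al * ln (Cmod z) + - al * ln (Cmod z)) with 0 in HK by ring.
    rewrite exp_0, Rmult_1_r in HK. exact HK. }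
  assert (Hza : Cmod z0 <> a).
  { intros E. assert (H := Hedge z0 (or_introl E)). rewrite E in H, Hval. fold la in H, Hval.
    replace (eta * (la - la) ^ 2) with 0 in H by ring. rewrite exp_0 in H. lra. }
  assert (Hzb : Cmod z0 <> b).
  { intros E. assert (H := Hedge z0 (or_intror E)). rewrite E in H, Hval. fold L in H. lra. }
  set (x0 := ln (Cmod z0)) in *.
  assert (Hx0 : la < x0 < ln b) by (split; apply ln_increasing; lra).
  set (rho := Rmin (x0 - la) (ln b - x0)).
  assert (Hrho : 0 < rho) by (apply Rmin_pos; lra).
  assert (Hr1 := Rmin_l (x0 - la) (ln b - x0)). assert (Hr2 := Rmin_r (x0 - la) (ln b - x0)).
  fold rho in Hr1, Hr2.
  assert (Hin : forall s, Cmod s <= rho -> a <= Cmod (z0 * cexp s) <= b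
     /\ ln (Cmod (z0 * cexp s)) = x0 + fst s).
  { intros s Hs. destruct (fst_snd_Cmod s) as [H _]. apply Rabs_le_between in H.
    assert (E : Cmod (z0 * cexp s) = exp (x0 + fst s)).
    { rewrite Cmod_cexp_scale, exp_plus. unfold x0. rewrite exp_ln by lra. reflexivity. }
    rewrite E, ln_exp. repeat split; try reflexivity.
    - rewrite <- (exp_ln a) by lra. apply exp_le_compat. fold la. lra.
    - rewrite <- (exp_ln b) by lra. apply exp_le_compat. lra. }
  (* Minus the derivative of the exponent of [k] at [x0]. The factor [cexp (- be * s)] in [G]
     therefore cancels the linear part of the weight and leaves the decay
     [exp (- eta * fst s ^ 2)]. *)
  set (be := al - 2 * eta * (x0 - la)).
  set (G := fun s : C => (f (z0 * cexp s) * cexp (RtoC (- be) * s))%C).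
  assert (HG : forall s, Cmod (G s) = Cmod (f (z0 * cexp s)%C) * exp (- be * fst s)).
  { intros s. unfold G. now rewrite Cmod_cexp_scale, fst_R_mult. }
  assert (HGle : forall s, Cmod s <= rho ->
    Cmod (G s) <= Cmod (f z0) * exp (- eta * fst s ^ 2)).
  { intros s Hs. rewrite HG. destruct (Hin s Hs) as [Hs1 Hs2].
    specialize (Hmax _ Hs1). rewrite Hs2 in Hmax. unfold k in Hmax.
    apply (Rmult_le_compat_r (exp (al * (x0 + fst s) - eta * (x0 + fst s - la) ^ 2 - be * fst s)))
      in Hmax; [|left; apply exp_pos].
    rewrite !Rmult_assoc, <- !exp_plus in Hmax.
    match type of Hmax with _ * exp ?u <= _ * exp ?v =>
      replace u with (- be * fst s) in Hmax by ring;
      replace v with (- eta * fst s ^ 2) in Hmax by (unfold be; ring) end.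
    exact Hmax. }
  assert (HG0 : Cmod (G 0) = Cmod (f z0)).
  { rewrite HG, Cmult_cexp_0_r. cbn [fst RtoC]. rewrite Rmult_0_r, exp_0. ring. }
  assert (Hpos : 0 < Cmod (f z0)).
  { destruct (Cmod_ge_0 (f z0)) as [|E]; [assumption|]. rewrite <- E in Hval. lra. }
  assert (Hd0 : forall s : C, (s - 0)%C = s) by (intros; ring).
  (* [|G|] on the circle does not exceed its value at the centre, so [G] is constant there; but at
     the point [rho] the decay is strict. *)
  assert (E : G (RtoC rho) = G 0).
  { apply (mean_eq G 0 rho Hrho).
    - intros s Hs. rewrite Hd0 in Hs. unfold G. apply cdiff_mult.
      + apply cdiff_scale_cexp, Hf, Hin, Hs.
      + apply cdiff_cexp_linear.
    - intros s Hs. rewrite Hd0 in Hs. rewrite HG0. eapply Rle_trans; [apply HGle; lra|].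
      rewrite <- (Rmult_1_r (Cmod (f z0))) at 2. rewrite <- exp_0.
      apply Rmult_le_compat_l; [lra|]. apply exp_le_compat.
      assert (H := pow2_ge_0 (fst s)). nra.
    - rewrite Hd0, Cmod_R, Rabs_pos_eq; lra. }
  assert (H := HGle (RtoC rho)). rewrite E, HG0, Cmod_R, Rabs_pos_eq in H by lra.
  specialize (H (Rle_refl _)). cbn [fst RtoC] in H.
  assert (Hlt1 : exp (- eta * rho ^ 2) < 1).
  { rewrite <- exp_0. apply exp_increasing. assert (0 < rho ^ 2) by now apply pow_lt. nra. }
  nra.
Qed.

(** The mean value property bounds [f] at 0, hence by [K + eps] on a small circle; the remaining
    annulus is covered by [annulus_max] with exponent 0. *)
Lemma disc_max (f : C -> C) (r K : R) : 0 < r ->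
  (forall z, Cmod z <= r -> cdiff f z) ->
  (forall z, Cmod z = r -> Cmod (f z) <= K) ->
  forall z, Cmod z <= r -> Cmod (f z) <= K.
Proof.
  intros Hr Hf HK z Hz.
  assert (Hd0 : forall s : C, (s - 0)%C = s) by (intros; ring).
  assert (H0 : Cmod (f 0) <= K).
  { apply (max_disc_center f 0 r K Hr).
    - intros w Hw. rewrite Hd0 in Hw. auto.
    - intros w Hw. rewrite Hd0 in Hw. auto. }
  destruct (Req_dec (Cmod z) 0) as [E|Hz0].
  { apply Cmod_eq_0 in E. now rewrite E. }
  assert (Hzp := Cmod_ge_0 z).
  apply le_epsilon. intros eps He.
  assert (Hc : ccont f 0). { apply cdiff_ccont, Hf. rewrite Cmod_0. lra. }
  destruct (Hc eps He) as (d & Hd & H).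
  set (a := Rmin (Cmod z) d / 2).
  assert (Hm := Rmin_l (Cmod z) d). assert (Hm' := Rmin_r (Cmod z) d).
  assert (Ha : 0 < Rmin (Cmod z) d) by (apply Rmin_pos; lra).
  assert (G : Cmod (f z) <= (K + eps) * Rpower (Cmod z) 0).
  { apply (annulus_max f a r 0 (K + eps)); unfold a; try lra.
    - intros w Hw. apply Hf. lra.
    - intros w Hw. rewrite Rpower_O by lra. rewrite Rmult_1_r. destruct Hw as [Hw|Hw].
      + specialize (H w). rewrite Hd0 in H. specialize (H ltac:(lra)).
        assert (T := Cmod_triangle_rev (f w) (f 0)). lra.
      + specialize (HK w Hw). lra. }
  rewrite Rpower_O, Rmult_1_r in G by lra. exact G.
Qed.

Lemma max_modulus_spec (f : C -> C) (r : R) : 0 < r ->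
  (forall z, Cmod z = r -> ccont f z) ->
  (exists z, Cmod z = r /\ Cmod (f z) = max_modulus f r) /\
  forall z, Cmod z = r -> Cmod (f z) <= max_modulus f r.
Proof.
  intros Hr Hf.
  destruct (annulus_weighted_max f (fun _ => 1) r r) as (z0 & Hz0 & H).
  - lra.
  - intros z Hz. apply Hf. lra.
  - intros x _. apply continuity_pt_const. intros u v. reflexivity.
  - assert (Hmax : forall z, Cmod z = r -> Cmod (f z) <= Cmod (f z0)).
    { intros z Hz. specialize (H z ltac:(lra)). lra. }
    assert (E : max_modulus f r = Cmod (f z0)).
    { unfold max_modulus. rewrite (is_lub_Rbar_unique _ (Finite (Cmod (f z0)))); [reflexivity|].
      split.
      - intros y (z & Hz & ->). cbn. auto.
      - intros b Hb. apply Hb. exists z0. split; [lra|reflexivity]. }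
    rewrite E. split; [|assumption]. exists z0. split; [lra|reflexivity].
Qed.

(** A Schwarz lemma with [sqrt (|z| / r)] in place of [|z| / r]. Near 0 the linear bound on [f] lies
    below any multiple of [sqrt |z|], so [annulus_max] with exponent 1/2 applies and no singularity
    of [f z / z] has to be removed. *)
Lemma schwarz_sqrt (f : C -> C) (r : R) : 0 < r ->
  (forall z, Cmod z <= r -> cdiff f z) ->
  (forall z, Cmod z <= r -> Cmod (f z) <= 1) -> f 0 = 0 ->
  forall z, Cmod z <= r / 4 -> Cmod (f z) <= 1 / 2.
Proof.
  intros Hr Hf H1 Hf0 z Hz.
  destruct (Req_dec (Cmod z) 0) as [E|Hz0].
  { apply Cmod_eq_0 in E. rewrite E, Hf0, Cmod_0. lra. }
  assert (Hzp := Cmod_ge_0 z).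
  destruct (cdiff_elim f 0) as (l & Hl). { apply Hf. rewrite Cmod_0. lra. }
  destruct (Hl 1 Rlt_0_1) as (d & Hd & H).
  set (B := 1 + Cmod l). assert (HB : 1 <= B) by (unfold B; assert (T := Cmod_ge_0 l); lra).
  assert (Hlin : forall w, Cmod w < d -> Cmod (f w) <= B * Cmod w).
  { intros w Hw. specialize (H w). rewrite Hf0 in H.
    replace (w - 0)%C with w in H by ring. specialize (H Hw).
    replace (f w) with ((f w - 0 - l * w) + l * w)%C by ring.
    eapply Rle_trans; [apply Cmod_triangle|]. rewrite Cmod_mult. unfold B. lra. }
  (* On the circle of radius [q / 2] the linear bound [B * |w|] is then at most [sqrt (|w| / r)]. *)
  set (q := Rmin (Cmod z) (Rmin d (/ (r * B ^ 2)))).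
  assert (HB2 : 0 < B ^ 2) by (apply pow_lt; lra).
  assert (Hr2 : 0 < r * B ^ 2) by now apply Rmult_lt_0_compat.
  assert (Hr3 : 0 < / (r * B ^ 2)) by now apply Rinv_0_lt_compat.
  assert (Hq : 0 < q) by (repeat apply Rmin_pos; lra).
  assert (Hq1 : q <= Cmod z) by apply Rmin_l.
  assert (Hq2 : q <= d) by (eapply Rle_trans; [apply Rmin_r|apply Rmin_l]).
  assert (Hq3 : q <= / (r * B ^ 2)) by (eapply Rle_trans; [apply Rmin_r|apply Rmin_r]).
  assert (Hsr : 0 < sqrt r) by now apply sqrt_lt_R0.
  assert (G := annulus_max f (q / 2) r (/ 2) (/ sqrt r)).
  assert (HG : Cmod (f z) <= / sqrt r * Rpower (Cmod z) (/ 2)).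
  { apply G; [lra| | |lra].
    - intros w Hw. apply Hf. lra.
    - intros w [Hw|Hw]; rewrite Hw, Rpower_sqrt by lra.
      + eapply Rle_trans; [apply Hlin; lra|]. rewrite Hw.
        assert (Hs : sqrt (q / 2) * sqrt (q / 2) = q / 2) by (apply sqrt_sqrt; lra).
        assert (Hs0 : 0 < sqrt (q / 2)) by (apply sqrt_lt_R0; lra).
        assert (Hb : B * sqrt (q / 2) <= / sqrt r).
        { apply Rmult_le_reg_r with (sqrt r); [assumption|]. rewrite Rinv_l by lra.
          rewrite <- sqrt_1. rewrite Rmult_assoc, <- sqrt_mult_alt by lra.
          rewrite <- (sqrt_pow2 B) by lra. rewrite <- sqrt_mult_alt by lra.
          apply sqrt_le_1_alt.
          apply (Rmult_le_compat_l (r * B ^ 2)) in Hq3; [|lra]. rewrite Rinv_r in Hq3 by lra.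
          nra. }
        apply Rle_trans with (B * sqrt (q / 2) * sqrt (q / 2)).
        * rewrite Rmult_assoc, Hs. lra.
        * apply Rmult_le_compat_r; lra.
      + rewrite Rinv_l by lra. apply H1. lra. }
  rewrite Rpower_sqrt in HG by lra. eapply Rle_trans; [apply HG|].
  apply Rle_trans with (/ sqrt r * sqrt (r / 4)).
  - apply Rmult_le_compat_l; [left; now apply Rinv_0_lt_compat|]. now apply sqrt_le_1_alt.
  - right. replace (r / 4) with (r * (1 / 2) ^ 2) by field.
    rewrite sqrt_mult_alt, sqrt_pow2 by lra. field. lra.
Qed.

(* The automorphism [u |-> E (u - 1) / (E ^ 2 - u)] of the disc of radius [E]
   reduces this to a Schwarz lemma. *)
Lemma near_one (u : C -> C) (r E : R) : 0 < r -> 1 < E ->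
  (forall z, Cmod z <= r -> cdiff u z) ->
  (forall z, Cmod z <= r -> Cmod (u z) <= E) -> u 0 = 1 ->
  forall z, Cmod z <= r / 4 -> Cmod (u z - 1) <= E ^ 2 - 1.
Proof.
  intros Hr HE Hu HuE Hu0 z Hz.
  assert (HE2 : E < E ^ 2) by nra.
  assert (Hden : forall z, Cmod z <= r -> (RtoC (E ^ 2) - u z)%C <> 0).
  { intros w Hw E0. apply Ceq_minus in E0. specialize (HuE w Hw).
    rewrite <- E0, Cmod_R, Rabs_pos_eq in HuE; lra. }
  set (w := fun z => (RtoC E * (u z - 1) * / (RtoC (E ^ 2) - u z))%C).
  assert (Hw : Cmod (w z) <= 1 / 2).
  { apply (schwarz_sqrt w r Hr); [| | |assumption].
    - intros s Hs. unfold w. apply cdiff_mult.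
      + apply cdiff_mult; [apply cdiff_const|]. apply cdiff_minus; [auto|apply cdiff_const].
      + apply (cdiff_comp Cinv (fun z => RtoC (E ^ 2) - u z)%C).
        * apply cdiff_minus; [apply cdiff_const|auto].
        * now apply cdiff_inv, Hden.
    - intros s Hs. specialize (Hden s Hs). specialize (HuE s Hs). unfold w.
      assert (Hp : 0 < Cmod (RtoC (E ^ 2) - u s)) by now apply Cmod_gt_0.
      rewrite Cmod_mult, Cmod_inv by assumption.
      apply Rmult_le_reg_r with (Cmod (RtoC (E ^ 2) - u s)); [assumption|].
      rewrite Rmult_assoc, Rinv_l, Rmult_1_r, Rmult_1_l by lra.
      assert (A1 := Cmod2_alt (RtoC E * (u s - 1))). assert (A2 := Cmod2_alt (RtoC (E ^ 2) - u s)).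
      assert (A3 := Cmod2_alt (u s)). assert (A0 := Cmod_ge_0 (u s)).
      assert (Hu2 : Cmod (u s) ^ 2 <= E ^ 2) by (apply pow_incr; lra).
      unfold Re, Im in A1, A2, A3. cbn [fst snd Cminus Cplus Copp Cmult RtoC] in A1, A2.
      (* The difference of the two sides is [(E ^ 2 - 1) * (E ^ 2 - |u s| ^ 2)]. *)
      assert (Hsq : Cmod (RtoC E * (u s - 1)) ^ 2 <= Cmod (RtoC (E ^ 2) - u s) ^ 2).
      { rewrite A1, A2. rewrite A3 in Hu2. nra. }
      assert (Hn := Cmod_ge_0 (RtoC E * (u s - 1))). nra.
    - unfold w. rewrite Hu0. replace (1 - 1)%C with (RtoC 0) by ring.
      now rewrite Cmult_0_r, Cmult_0_l. }
  assert (Hzr : Cmod z <= r) by (assert (H := Cmod_ge_0 z); lra).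
  assert (Eq : (RtoC E * (u z - 1) = w z * (RtoC (E ^ 2) - u z))%C).
  { unfold w. rewrite <- Cmult_assoc, Cinv_l, Cmult_1_r by now apply Hden. reflexivity. }
  apply (f_equal Cmod) in Eq. rewrite !Cmod_mult, Cmod_R, Rabs_pos_eq in Eq by lra.
  (* With [|w z| <= 1 / 2] this gives [(E - 1 / 2) * |u z - 1| <= (E ^ 2 - 1) / 2], and
     [E - 1 / 2 > 1 / 2]. *)
  assert (Ht : Cmod (RtoC (E ^ 2) - u z) <= (E ^ 2 - 1) + Cmod (u z - 1)).
  { replace (RtoC (E ^ 2) - u z)%C with (RtoC (E ^ 2 - 1) - (u z - 1))%C
      by (rewrite RtoC_minus; ring).
    eapply Rle_trans; [apply Cmod_minus_le|]. rewrite Cmod_R, Rabs_pos_eq by nra. lra. }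
  assert (H0 := Cmod_ge_0 (u z - 1)). assert (H1 := Cmod_ge_0 (w z)). nra.
Qed.

(** * Growth of the maximum modulus *)

Definition centire (f : C -> C) : Prop := forall z, cdiff f z.

Definition nonconstant (f : C -> C) : Prop := forall c : C, exists z, f z <> c.

Lemma max_modulus_attained (f : C -> C) (r : R) : centire f -> 0 < r ->
  exists z, Cmod z = r /\ Cmod (f z) = max_modulus f r.
Proof. intros Hf Hr. apply max_modulus_spec; auto. intros z _. apply cdiff_ccont, Hf. Qed.

Lemma Cmod_le_max_modulus (f : C -> C) (r : R) (z : C) : centire f -> 0 < r ->
  Cmod z <= r -> Cmod (f z) <= max_modulus f r.
Proof.
  intros Hf Hr. apply disc_max; auto. intros w Hw. apply max_modulus_spec; auto.
  intros y _. apply cdiff_ccont, Hf.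
Qed.

Lemma max_modulus_mono (f : C -> C) (r s : R) : centire f -> 0 < r <= s ->
  max_modulus f r <= max_modulus f s.
Proof.
  intros Hf Hr. destruct (max_modulus_attained f r Hf) as (z & Hz & <-); [lra|].
  apply Cmod_le_max_modulus; auto; lra.
Qed.

Lemma max_modulus_nonneg (f : C -> C) (r : R) : centire f -> 0 < r -> 0 <= max_modulus f r.
Proof.
  intros Hf Hr. destruct (max_modulus_attained f r Hf Hr) as (z & _ & <-). apply Cmod_ge_0.
Qed.

(** Otherwise [|f|] has a global maximum at some [z0] on the unit circle, and [mean_eq] on the
    circle about [z0] through an arbitrary [w] yields [f w = f z0]. *)
Lemma liouville (f : C -> C) : centire f -> nonconstant f ->
  exists r, 1 < r /\ max_modulus f 1 < max_modulus f r.
Proof.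
  intros Hf Hn. apply NNPP. intros Hno.
  assert (HM : forall r, 1 < r -> max_modulus f r <= max_modulus f 1).
  { intros r Hr. apply Rnot_lt_le. intros H. apply Hno. now exists r. }
  assert (Hb : forall z, Cmod (f z) <= max_modulus f 1).
  { intros z. apply Rle_trans with (max_modulus f (Cmod z + 2)).
    - apply Cmod_le_max_modulus; auto; assert (H := Cmod_ge_0 z); lra.
    - apply HM. assert (H := Cmod_ge_0 z). lra. }
  destruct (max_modulus_attained f 1 Hf Rlt_0_1) as (z0 & _ & H0).
  destruct (Hn (f z0)) as (w & Hw). apply Hw.
  assert (Hne : (w - z0)%C <> 0) by (apply Cminus_eq_contra; intros ->; now apply Hw).
  apply (mean_eq f z0 (Cmod (w - z0))).
  - now apply Cmod_gt_0.
  - intros z _. apply Hf.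
  - intros z _. now rewrite H0.
  - reflexivity.
Qed.

(** Hadamard's theorem with inner radius 1: the comparison function [A * |z| ^ al] equals [M(r, f)]
    on the outer circle. The positive bound [A] stands in for [M(1, f)], so that the logarithm of
    the quotient makes sense. *)
Lemma three_circles (f : C -> C) (A s r : R) : centire f -> 1 <= s <= r -> 1 < r ->
  0 < A -> max_modulus f 1 <= A -> 0 < max_modulus f r ->
  max_modulus f s <= A * Rpower s (ln (max_modulus f r / A) / ln r).
Proof.
  intros Hf Hs Hr HA H1 HMr.
  destruct (max_modulus_attained f s Hf) as (z & Hz & <-); [lra|]. rewrite <- Hz.
  assert (Hln : 0 < ln r) by (rewrite <- ln_1; apply ln_increasing; lra).
  assert (Hq : 0 < max_modulus f r / A) by now apply Rdiv_lt_0_compat.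
  apply (annulus_max f 1 r); [lra|auto| |lra].
  intros w [Hw|Hw]; rewrite Hw; unfold Rpower.
  - rewrite ln_1, Rmult_0_r, exp_0, Rmult_1_r. eapply Rle_trans; [|apply H1].
    apply Cmod_le_max_modulus; auto; lra.
  - replace (ln (max_modulus f r / A) / ln r * ln r) with (ln (max_modulus f r / A))
      by (field; lra).
    rewrite exp_ln by assumption.
    replace (A * (max_modulus f r / A)) with (max_modulus f r) by (field; lra).
    apply Cmod_le_max_modulus; auto; lra.
Qed.

(** By convexity the slope from the inner circle to radius [r] is at least the slope [c > 0] to the
    radius [r1] given by [liouville], so [M(r, f) >= A * r ^ c]. *)
Lemma max_modulus_ge_Rpower (f : C -> C) : centire f -> nonconstant f ->
  exists c r0, 0 < c /\ 1 < r0 /\ forall r, r0 <= r -> Rpower r c <= max_modulus f r.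
Proof.
  intros Hf Hn. destruct (liouville f Hf Hn) as (r1 & Hr1 & HM).
  assert (HM1 := max_modulus_nonneg f 1 Hf Rlt_0_1).
  set (A := (max_modulus f 1 + max_modulus f r1) / 2).
  assert (HA : 0 < A /\ max_modulus f 1 <= A < max_modulus f r1) by (unfold A; lra).
  assert (Hl1 : 0 < ln r1) by (rewrite <- ln_1; apply ln_increasing; lra).
  assert (Hq : 1 < max_modulus f r1 / A).
  { apply Rmult_lt_reg_r with A; [lra|]. unfold Rdiv. rewrite Rmult_assoc, Rinv_l; lra. }
  assert (Hlq : 0 < ln (max_modulus f r1 / A)) by (rewrite <- ln_1; apply ln_increasing; lra).
  set (c := ln (max_modulus f r1 / A) / ln r1).
  assert (Hc : 0 < c) by now apply Rdiv_lt_0_compat.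
  (* Beyond the second term [A * r ^ (c / 2) >= 1]: half of the exponent is spent on the constant
     [A]. *)
  set (r0 := Rmax r1 (exp (- 2 * ln A / c))).
  exists (c / 2), r0. split; [lra|]. split; [apply Rlt_le_trans with r1; [lra|apply Rmax_l]|].
  intros r Hr.
  assert (Hrr1 : r1 <= r) by (eapply Rle_trans; [apply Rmax_l|apply Hr]).
  assert (HrA : exp (- 2 * ln A / c) <= r) by (eapply Rle_trans; [apply Rmax_r|apply Hr]).
  assert (Hlr : 0 < ln r) by (rewrite <- ln_1; apply ln_increasing; lra).
  assert (HMr : 0 < max_modulus f r).
  { apply Rlt_le_trans with (max_modulus f r1); [lra|]. apply max_modulus_mono; auto; lra. }
  assert (H3 := three_circles f A r1 r Hf ltac:(lra) ltac:(lra) ltac:(lra) ltac:(lra) HMr).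
  set (al := ln (max_modulus f r / A) / ln r) in *.
  assert (Hal : c <= al).
  { unfold c. apply Rmult_le_reg_r with (ln r1); [assumption|].
    unfold Rdiv. rewrite Rmult_assoc, Rinv_l, Rmult_1_r by lra.
    rewrite <- (ln_exp (al * ln r1)). apply ln_le; [lra|].
    apply Rmult_le_reg_r with A; [lra|]. rewrite Rmult_assoc, Rinv_l, Rmult_1_r by lra.
    unfold Rpower in H3. lra. }
  assert (Hqr : 0 < max_modulus f r / A) by (apply Rdiv_lt_0_compat; lra).
  assert (E : max_modulus f r = exp (ln A + al * ln r)).
  { rewrite exp_plus, exp_ln by lra. unfold al.
    replace (ln (max_modulus f r / A) / ln r * ln r) with (ln (max_modulus f r / A))
      by (field; lra).
    rewrite exp_ln by assumption. field. lra. }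
  rewrite E. unfold Rpower. apply exp_le_compat.
  apply ln_le in HrA; [|apply exp_pos]. rewrite ln_exp in HrA.
  apply (Rmult_le_compat_r (c / 2)) in HrA; [|lra].
  replace (- 2 * ln A / c * (c / 2)) with (- ln A) in HrA by (field; lra).
  nra.
Qed.

Lemma max_modulus_unbounded (f : C -> C) (K : R) : centire f -> nonconstant f ->
  exists r0, 1 < r0 /\ forall r, r0 <= r -> K <= max_modulus f r.
Proof.
  intros Hf Hn. destruct (max_modulus_ge_Rpower f Hf Hn) as (c & r1 & Hc & Hr1 & H).
  set (K' := Rmax K 1).
  exists (Rmax r1 (exp (ln K' / c))). split.
  - apply Rlt_le_trans with r1; [lra|apply Rmax_l].
  - intros r Hr. assert (H1 : r1 <= r) by (eapply Rle_trans; [apply Rmax_l|apply Hr]).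
    assert (H2 : exp (ln K' / c) <= r) by (eapply Rle_trans; [apply Rmax_r|apply Hr]).
    eapply Rle_trans; [|now apply H]. apply Rle_trans with K'; [apply Rmax_l|].
    assert (HK' : 0 < K') by (apply Rlt_le_trans with 1; [lra|apply Rmax_r]).
    rewrite <- (exp_ln K') at 1 by assumption. unfold Rpower. apply exp_le_compat.
    apply ln_le in H2; [|apply exp_pos]. rewrite ln_exp in H2.
    apply (Rmult_le_compat_r c) in H2; [|lra].
    unfold Rdiv in H2. rewrite Rmult_assoc, Rinv_l in H2 by lra. lra.
Qed.

Lemma exp_pow (x : R) (n : nat) : exp x ^ n = exp (INR n * x).
Proof.
  induction n as [|n IH].
  - cbn. now rewrite Rmult_0_l, exp_0.
  - rewrite S_INR. cbn [pow]. rewrite IH, <- exp_plus. f_equal. ring.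
Qed.

(** Convexity gives [(M(r) / A) ^ (2 k) <= M(r ^ (2 k)) / A]. The factor 2 in the exponent pays for
    [A]: once [M(r) >= A ^ 2], one has [(M(r) / A) ^ 2 >= M(r)]. *)
Lemma max_modulus_pow (f : C -> C) (k : nat) : centire f -> nonconstant f -> (1 <= k)%nat ->
  exists r0, 1 < r0 /\ forall r, r0 <= r ->
    max_modulus f r ^ k <= max_modulus f (r ^ (2 * k)).
Proof.
  intros Hf Hn Hk. set (A := max_modulus f 1 + 1).
  assert (HM1 := max_modulus_nonneg f 1 Hf Rlt_0_1).
  destruct (max_modulus_unbounded f (A ^ 2) Hf Hn) as (r0 & Hr0 & H).
  exists r0. split; [assumption|]. intros r Hr. specialize (H r Hr).
  assert (HA : 1 <= A) by (unfold A; lra).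
  assert (HMr : 0 < max_modulus f r) by nra.
  assert (Hrk : r <= r ^ (2 * k)).
  { rewrite <- (pow_1 r) at 1. apply Rle_pow; [lra|lia]. }
  assert (HMR : 0 < max_modulus f (r ^ (2 * k))).
  { eapply Rlt_le_trans; [apply HMr|]. apply max_modulus_mono; auto; lra. }
  assert (H3 := three_circles f A r (r ^ (2 * k)) Hf ltac:(lra) ltac:(lra) ltac:(lra)
    ltac:(unfold A; lra) HMR).
  assert (Hlr : 0 < ln r) by (rewrite <- ln_1; apply ln_increasing; lra).
  assert (HkR : 0 < INR (2 * k)) by (apply lt_0_INR; lia).
  unfold Rpower in H3. rewrite ln_pow in H3 by lra.
  set (R' := max_modulus f (r ^ (2 * k))) in *.
  replace (ln (R' / A) / (INR (2 * k) * ln r) * ln r) with (ln (R' / A) / INR (2 * k)) in H3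
    by (field; lra).
  assert (H4 : (max_modulus f r / A) ^ (2 * k) <= R' / A).
  { apply Rle_trans with (exp (ln (R' / A) / INR (2 * k)) ^ (2 * k)).
    - apply pow_incr. split.
      + left. apply Rdiv_lt_0_compat; lra.
      + apply Rmult_le_reg_r with A; [lra|]. unfold Rdiv at 1.
        rewrite Rmult_assoc, Rinv_l by lra. lra.
    - rewrite exp_pow. right.
      replace (INR (2 * k) * (ln (R' / A) / INR (2 * k))) with (ln (R' / A)) by (field; lra).
      apply exp_ln. apply Rdiv_lt_0_compat; lra. }
  apply Rle_trans with ((max_modulus f r / A) ^ (2 * k)).
  - rewrite pow_mult. apply pow_incr. split; [lra|].
    apply Rmult_le_reg_r with (A ^ 2); [nra|].
    replace ((max_modulus f r / A) ^ 2 * A ^ 2) with (max_modulus f r ^ 2) by (field; lra).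
    nra.
  - eapply Rle_trans; [apply H4|].
    apply Rmult_le_reg_r with A; [lra|]. unfold Rdiv. rewrite Rmult_assoc, Rinv_l by lra. nra.
Qed.

(** If the imaginary part of [s] is at least 2/3 in absolute value, the line through 0 and [cexp s]
    has distance at least sin (pi / 6) from 1; otherwise the real part exceeds 7/10 in absolute
    value and the modulus of [cexp s] is far from 1. *)
Lemma Cmod_cexp_minus_1 (s : C) : Cmod s = 1 -> 3 / 10 <= Cmod (cexp s - 1).
Proof.
  intros Hs. assert (HPI1 := PI_4). assert (HPI2 := PI2_1). assert (HPI := PI_RGT_0).
  assert (H1 := Cmod2_alt s). rewrite Hs in H1. unfold Re, Im in H1.
  assert (H2 := Cmod2_alt (cexp s - 1)). unfold Re, Im in H2.
  assert (H3 := Cmod_ge_0 (cexp s - 1)).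
  destruct (fst_snd_Cmod s) as [_ Hy]. rewrite Hs in Hy. apply Rabs_le_between in Hy.
  destruct (Rle_lt_dec (2 / 3) (Rabs (snd s))) as [Hc|Hc].
  - assert (Hsin : 1 / 2 <= Rabs (sin (snd s))).
    { assert (Hpos : forall y, 2 / 3 <= y <= 1 -> 1 / 2 <= sin y).
      { intros y Hy'. rewrite <- sin_PI6. apply sin_incr_1; lra. }
      unfold Rabs in Hc. destruct (Rcase_abs (snd s)).
      - assert (H := Hpos (- snd s) ltac:(lra)). rewrite sin_neg in H.
        rewrite Rabs_left1 by lra. lra.
      - assert (H := Hpos (snd s) ltac:(lra)). rewrite Rabs_pos_eq; lra. }
    assert (Hs2 : 1 / 4 <= sin (snd s) ^ 2).
    { rewrite <- pow2_abs. nra. }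
    assert (Hsc := sin2_cos2 (snd s)). unfold Rsqr in Hsc.
    cbn [fst snd Cminus Cplus Copp cexp RtoC] in H2.
    set (t := exp (fst s)) in *. set (c := cos (snd s)) in *. set (d := sin (snd s)) in *.
    assert (H4 : d ^ 2 <= Cmod (cexp s - 1) ^ 2).
    { rewrite H2. replace ((t * c + - (1)) ^ 2 + (t * d + - 0) ^ 2)
        with (t ^ 2 * (d * d + c * c) - 2 * t * c + 1) by ring.
      rewrite Hsc. assert (H := pow2_ge_0 (t - c)). nra. }
    nra.
  - assert (Hx : 7 / 10 < Rabs (fst s)).
    { rewrite <- (pow2_abs (fst s)), <- (pow2_abs (snd s)) in H1.
      assert (Hp := Rabs_pos (fst s)). assert (Hp' := Rabs_pos (snd s)). nra. }
    unfold Rabs in Hx. destruct (Rcase_abs (fst s)).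
    + assert (T := Cmod_triangle_rev 1 (cexp s)). rewrite Cmod_minus_sym, Cmod_1, Cmod_cexp in T.
      assert (He := exp_ineq1_le (- fst s)). assert (Hm := exp_plus (fst s) (- fst s)).
      rewrite Rplus_opp_r, exp_0 in Hm. assert (Hp := exp_pos (fst s)). nra.
    + assert (T := Cmod_triangle_rev (cexp s) 1). rewrite Cmod_1, Cmod_cexp in T.
      assert (He := exp_ineq1_le (fst s)). lra.
Qed.

(** * Images of discs *)

(** By [exp x >= 1 + x], since [(1 - y) * (1 + y + 2 y ^ 2) = 1 + y ^ 2 * (1 - 2 y)]. It bounds the
    ratio of two values of the weight up to a quadratic error. *)
Lemma inv_one_minus_le (y : R) : y <= 1 / 2 -> 1 <= (1 - y) * exp (y + 2 * y ^ 2).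
Proof.
  intros Hy. assert (H := exp_ineq1_le (y + 2 * y ^ 2)). assert (Hs := pow2_ge_0 y).
  apply Rle_trans with ((1 - y) * (1 + (y + 2 * y ^ 2))).
  - nra.
  - apply Rmult_le_compat_l; lra.
Qed.

(* If [g (z0 * exp t)] is close to [g z0 * exp (N * t)] near [t = 0], it takes all
   values of modulus [|g z0|]: otherwise [1 / (g - w)] violates the maximum
   principle. *)
Lemma covers_circle (g : C -> C) (z0 w : C) (N rho : R) :
  centire g -> 0 < N -> g z0 <> 0 -> Cmod w = Cmod (g z0) ->
  (forall t, Cmod t <= 10 / N -> Cmod (z0 * cexp t) <= rho) ->
  (forall t, Cmod t <= 10 / N ->
     Cmod (g (z0 * cexp t) * cexp (RtoC (- N) * t) / g z0 - 1)%C <= 1 / 40) ->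
  exists z, Cmod z <= rho /\ g z = w.
Proof.
  intros Hg HN Hz0 Hw Hrho Hu. apply NNPP. intros Hno.
  assert (Hgp : 0 < Cmod (g z0)) by now apply Cmod_gt_0.
  assert (Hw0 : w <> 0) by (apply Cmod_gt_0; lra).
  destruct (polar_form (w / g z0)%C) as (a & Ha & Ea).
  { intros E. apply (f_equal (fun v => v * g z0)%C) in E.
    rewrite Cmult_0_l in E. apply Hw0. rewrite <- E. field. exact Hz0. }
  rewrite Cmod_div, Hw in Ea by assumption. unfold Rdiv in Ea.
  rewrite Rinv_r, ln_1 in Ea by lra.
  assert (HPI := PI_4).
  (* Centred at the solution [t = i a / N] of [g z0 * exp (N t) = w] and scaled by [1 / N]. As
     [a <= 2 * PI <= 8], one has [|i a + s| <= 9] on the unit disc, which explains the radius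
     [10 / N]. *)
  set (T := fun s : C => (RtoC (/ N) * ((0%R, a) + s))%C).
  assert (HN1 : 0 < / N) by now apply Rinv_0_lt_compat.
  assert (HT : forall s, Cmod s <= 1 -> Cmod (T s) <= 10 / N).
  { intros s Hs. unfold T. rewrite Cmod_mult, Cmod_R, Rabs_pos_eq by lra.
    unfold Rdiv. rewrite (Rmult_comm 10). apply Rmult_le_compat_l; [lra|].
    eapply Rle_trans; [apply Cmod_triangle|].
    assert (H := Cmod_le_sum (0%R, a)). cbn in H.
    rewrite Rabs_R0, Rabs_pos_eq in H by lra. lra. }
  set (u := fun s => (g (z0 * cexp (T s)) * cexp (RtoC (- N) * T s) / g z0)%C).
  assert (HE : forall s, (g (z0 * cexp (T s)) - w = w * (u s * cexp s - 1))%C).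
  { intros s. assert (E1 : (cexp (RtoC (- N) * T s) * cexp (0%R, a) * cexp s = 1)%C).
    { rewrite <- !cexp_plus. rewrite <- cexp_0. f_equal. unfold T.
      rewrite RtoC_inv, RtoC_opp by lra. field. intros E. apply RtoC_inj in E. lra. }
    assert (E2 : (w = g z0 * cexp (0%R, a))%C) by (rewrite <- Ea; field; exact Hz0).
    unfold u. rewrite E2 at 2.
    transitivity (g (z0 * cexp (T s)) * (cexp (RtoC (- N) * T s) * cexp (0%R, a) * cexp s)
      - g z0 * cexp (0%R, a))%C.
    - rewrite E1, E2. ring.
    - field. exact Hz0. }
  set (H := fun s => (g (z0 * cexp (T s)) - w)%C).
  assert (Hne : forall s, Cmod s <= 1 -> H s <> 0).
  { intros s Hs E. apply Hno. exists (z0 * cexp (T s))%C. split.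
    - apply Hrho. now apply HT.
    - apply Ceq_minus. exact E. }
  assert (Hd : forall s, cdiff H s).
  { intros s. unfold H. apply cdiff_minus; [|apply cdiff_const].
    apply (cdiff_comp (fun t => g (z0 * cexp t)%C) T).
    - unfold T. apply cdiff_mult; [apply cdiff_const|].
      apply cdiff_plus; [apply cdiff_const|apply cdiff_id].
    - apply cdiff_scale_cexp, Hg. }
  assert (Hd0 : forall s : C, (s - 0)%C = s) by (intros; ring).
  (* On the unit circle [|H s| / |w| >= 3 / 10 - 3 / 40 > 1 / 5], while closeness to the exponential
     gives [|H 0| / |w| <= 1 / 40]. *)
  assert (HK : Cmod (/ H 0)%C <= 5 / Cmod w).
  { apply (max_disc_center (fun s => / H s)%C 0 1 (5 / Cmod w)); [lra| |].
    - intros s Hs. rewrite Hd0 in Hs. apply (cdiff_comp Cinv H); [apply Hd|].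
      now apply cdiff_inv, Hne.
    - intros s Hs. rewrite Hd0 in Hs. rewrite Cmod_inv by (apply Hne; lra).
      replace (5 / Cmod w) with (/ (Cmod w / 5)) by (field; lra).
      apply Rinv_le_contravar; [lra|]. unfold H. rewrite HE, Cmod_mult.
      unfold Rdiv. apply Rmult_le_compat_l; [lra|].
      replace (u s * cexp s - 1)%C with ((cexp s - 1) - (1 - u s) * cexp s)%C by ring.
      eapply Rle_trans; [|apply Cmod_triangle_rev].
      assert (A1 := Cmod_cexp_minus_1 s Hs). rewrite Cmod_mult, Cmod_cexp.
      assert (A2 := Hu (T s) (HT s ltac:(lra))). fold (u s) in A2. rewrite Cmod_minus_sym in A2.
      assert (A3 : exp (fst s) <= 3).
      { eapply Rle_trans; [|apply exp_le_3]. apply exp_le_compat.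
        destruct (fst_snd_Cmod s) as [A3 _]. assert (A4 := Rle_abs (fst s)). lra. }
      assert (A4 := exp_pos (fst s)). assert (A5 := Cmod_ge_0 (1 - u s)). nra. }
  rewrite Cmod_inv in HK by (apply Hne; rewrite Cmod_0; lra).
  assert (HH : Cmod (H 0) <= Cmod w / 40).
  { unfold H. rewrite HE, Cmod_mult, cexp_0, Cmult_1_r.
    unfold Rdiv. apply Rmult_le_compat_l; [lra|].
    assert (A2 := Hu (T 0) (HT 0 ltac:(rewrite Cmod_0; lra))). fold (u 0) in A2. lra. }
  assert (HHp : 0 < Cmod (H 0)) by (apply Cmod_gt_0, Hne; rewrite Cmod_0; lra).
  assert (Hi := Rinv_le_contravar _ _ HHp HH).
  replace (/ (Cmod w / 40)) with (40 / Cmod w) in Hi by (field; lra).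
  assert (0 < / Cmod w) by (apply Rinv_0_lt_compat; lra). unfold Rdiv in *. lra.
Qed.

(* The point [z0] maximises [|g z| (8 ln r - ln |z|) ^ n]. With [D = 8 ln r - ln |z0|]
   and [N = n / D], maximality says that [g (z0 exp t) exp (- N t) / g z0] has modulus
   at most [(1 - Re t / D) ^ -n exp (- N Re t)], which is close to [1]. *)
Lemma image_contains_circle (g : C -> C) : centire g -> nonconstant g ->
  exists r0, 1 < r0 /\ forall r, r0 <= r -> exists s, max_modulus g r <= s /\
    forall w, Cmod w = s -> exists z, Cmod z <= r ^ 8 /\ g z = w.
Proof.
  (* The exponent of the error is [2 n y ^ 2] with [|y| <= 40 / n], that is at most [3200 / n]; it
     has to be at most 1/100. *)
  intros Hg Hn. destruct (INR_unbounded 320000) as (n & HA).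
  (* The weight costs a factor [2 ^ n]; once [M(r, g)] exceeds it, [M(r, g) ^ 2 <= 2 ^ n * |g z0|]
     still yields [|g z0| >= M(r, g)]. *)
  destruct (max_modulus_unbounded g (2 ^ n + 1) Hg Hn) as (r1 & Hr1 & H1).
  destruct (max_modulus_pow g 2 Hg Hn ltac:(lia)) as (r2 & Hr2 & H2).
  exists (Rmax r1 r2). split; [eapply Rlt_le_trans; [apply Hr1|apply Rmax_l]|].
  intros r Hr.
  specialize (H1 r ltac:(eapply Rle_trans; [apply Rmax_l|apply Hr])).
  specialize (H2 r ltac:(eapply Rle_trans; [apply Rmax_r|apply Hr])).
  replace (2 * 2)%nat with 4%nat in H2 by reflexivity.
  assert (Hr1' : 1 < r) by (assert (T := Rmax_l r1 r2); lra).
  set (l := ln r). assert (Hl : 0 < l) by (unfold l; rewrite <- ln_1; apply ln_increasing; lra).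
  assert (Hl8 : ln (r ^ 8) = 8 * l) by (rewrite ln_pow by lra; cbn [INR]; unfold l; ring).
  assert (Hl4 : ln (r ^ 4) = 4 * l) by (rewrite ln_pow by lra; cbn [INR]; unfold l; ring).
  assert (Hr8 : 1 < r ^ 8) by (apply Rlt_pow_R1; [lra|lia]).
  assert (Hr4 : 1 < r ^ 4) by (apply Rlt_pow_R1; [lra|lia]).
  assert (Hr48 : r ^ 4 <= r ^ 8) by (apply Rle_pow; [lra|lia]).
  assert (HP : 0 < 2 ^ n) by (apply pow_lt; lra).
  assert (Hn0 : (0 < n)%nat) by (apply INR_lt; cbn; lra).
  destruct (annulus_weighted_max g (fun x => (8 * l - x) ^ n) 1 (r ^ 8)) as (z0 & Hz0 & Hmax).
  { lra. } { intros z _. apply cdiff_ccont, Hg. }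
  { intros x _. apply derivable_continuous_pt, ex_derive_Reals_0. auto_derive. auto. }
  set (t0 := ln (Cmod z0)) in *. set (D := 8 * l - t0).
  assert (Ht0 : 0 <= t0 <= 8 * l).
  { unfold t0. rewrite <- Hl8, <- ln_1. split; apply ln_le; lra. }
  (* The maximum is compared with the value on [|z| = r ^ 4], where the logarithmic distance to the
     outer circle is half of the largest possible one; this is the origin of [2 ^ n]. *)
  assert (Hv4 : max_modulus g (r ^ 4) * (4 * l) ^ n <= Cmod (g z0) * D ^ n).
  { destruct (max_modulus_attained g (r ^ 4) Hg) as (z4 & Hz4 & <-); [lra|].
    assert (T := Hmax z4 ltac:(lra)). rewrite Hz4, Hl4 in T.
    replace (8 * l - 4 * l) with (4 * l) in T by ring. exact T. }
  assert (H4n : 0 < (4 * l) ^ n) by (apply pow_lt; lra).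
  assert (Hg0 := Cmod_ge_0 (g z0)).
  assert (Hle : max_modulus g (r ^ 4) <= 2 ^ n * Cmod (g z0)).
  { apply Rmult_le_reg_r with ((4 * l) ^ n); [assumption|].
    eapply Rle_trans; [apply Hv4|].
    replace (2 ^ n * Cmod (g z0) * (4 * l) ^ n) with (Cmod (g z0) * (2 * (4 * l)) ^ n)
      by (rewrite Rpow_mult_distr; ring).
    apply Rmult_le_compat_l; [assumption|]. apply pow_incr. unfold D. lra. }
  assert (HMg : max_modulus g r <= Cmod (g z0)) by nra.
  assert (Hgp : 0 < Cmod (g z0)) by lra.
  (* Inside [|z| < r] one would have [|g z0| <= M(r, g)], hence [M(r, g) <= 2 ^ n]. So [z0] keeps a
     logarithmic distance of at least [l] from the inner circle, more than [D / 8000]. *)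
  assert (Ht0l : l <= t0).
  { apply Rnot_lt_le. intros Hlt.
    assert (Hz0r : Cmod z0 <= r).
    { rewrite <- (exp_ln (Cmod z0)), <- (exp_ln r) by lra. apply exp_le_compat.
      fold l t0. lra. }
    assert (T := Cmod_le_max_modulus g r z0 Hg ltac:(lra) Hz0r). nra. }
  assert (HD : 0 < D).
  { destruct (Req_dec D 0) as [E|]; [|unfold D in *; lra].
    rewrite E, pow_i, Rmult_0_r in Hv4 by assumption.
    assert (HM4 : 0 < max_modulus g (r ^ 4)) by nra.
    assert (T := Rmult_lt_0_compat _ _ HM4 H4n). lra. }
  set (N := INR n / D). assert (HN : 0 < N) by (apply Rdiv_lt_0_compat; lra).
  assert (HND : forall K, K / N = K * D / INR n) by (intros K; unfold N; field; lra).
  assert (Hin : forall t, Cmod t <= 40 / N -> Rabs (fst t / D) <= 40 / INR n /\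
    1 <= Cmod (z0 * cexp t) <= r ^ 8 /\ ln (Cmod (z0 * cexp t)) = t0 + fst t).
  { intros t Ht. destruct (fst_snd_Cmod t) as [Hf _].
    assert (Hy : Rabs (fst t / D) <= 40 / INR n).
    { unfold Rdiv at 1. rewrite Rabs_mult, (Rabs_pos_eq (/ D))
        by (left; now apply Rinv_0_lt_compat).
      apply Rmult_le_reg_r with D; [assumption|].
      rewrite Rmult_assoc, Rinv_l, Rmult_1_r by lra.
      rewrite HND in Ht. replace (40 / INR n * D) with (40 * D / INR n) by (field; lra). lra. }
    split; [assumption|].
    assert (E : Cmod (z0 * cexp t) = exp (t0 + fst t)).
    { rewrite Cmod_cexp_scale, exp_plus. unfold t0. now rewrite exp_ln by lra. }
    rewrite E, ln_exp. split; [|reflexivity].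
    assert (Hn8 : 40 / INR n <= / 8000).
    { apply Rmult_le_reg_r with (INR n); [lra|]. unfold Rdiv.
      rewrite Rmult_assoc, Rinv_l by lra. lra. }
    assert (Hx : Rabs (fst t) <= D / 8000).
    { replace (fst t) with (fst t / D * D) by (field; lra).
      rewrite Rabs_mult, (Rabs_pos_eq D) by lra. nra. }
    apply Rabs_le_between in Hx. unfold D in Hx. split.
    - rewrite <- exp_0. apply exp_le_compat. lra.
    - rewrite <- (exp_ln (r ^ 8)) by lra. apply exp_le_compat. rewrite Hl8. lra. }
  exists (Cmod (g z0)). split; [assumption|]. intros w Hw.
  assert (Hgz : g z0 <> 0) by now apply Cmod_gt_0.
  (* [near_one] shrinks the radius by a factor 4, so the bound on [u] is established on the disc of
     radius [40 / N]. *)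
  assert (H1040 : 10 / N <= 40 / N).
  { apply Rmult_le_compat_r; [left; now apply Rinv_0_lt_compat|lra]. }
  apply (covers_circle g z0 w N (r ^ 8)); auto.
  - intros t Ht. apply Hin. lra.
  - set (u := fun t => (g (z0 * cexp t) * cexp (RtoC (- N) * t) / g z0)%C).
    set (E := exp (/ 100)).
    assert (HE : 1 < E) by (unfold E; rewrite <- exp_0; apply exp_increasing; lra).
    assert (HE2 : E ^ 2 - 1 <= 1 / 40).
    { unfold E. rewrite exp_pow. cbn [INR].
      assert (T := exp_ineq1_le (- ((1 + 1) * / 100))).
      assert (T' := exp_plus ((1 + 1) * / 100) (- ((1 + 1) * / 100))).
      rewrite Rplus_opp_r, exp_0 in T'. assert (T'' := exp_pos ((1 + 1) * / 100)). nra. }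
    intros t Ht. eapply Rle_trans; [|apply HE2].
    apply (near_one u (40 / N) E).
    + apply Rdiv_lt_0_compat; lra.
    + assumption.
    + intros s _. unfold u. apply cdiff_mult; [|apply cdiff_const].
      apply cdiff_mult; [apply cdiff_scale_cexp, Hg|apply cdiff_cexp_linear].
    + intros s Hs. destruct (Hin s Hs) as (Hy & Hs1 & Hs2).
      unfold u. rewrite Cmod_div, Cmod_mult, Cmod_cexp, fst_R_mult by assumption.
      specialize (Hmax _ Hs1). cbv beta in Hmax. rewrite Hs2 in Hmax.
      set (y := fst s / D) in *.
      assert (Ey : fst s = y * D) by (unfold y; field; lra).
      assert (Hn8 : 40 / INR n <= / 8000).
      { apply Rmult_le_reg_r with (INR n); [lra|]. unfold Rdiv.
        rewrite Rmult_assoc, Rinv_l by lra. lra. }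
      assert (Hy2 : y <= 1 / 2) by (assert (T := Rle_abs y); lra).
      replace (8 * l - (t0 + fst s)) with (D * (1 - y)) in Hmax by (rewrite Ey; unfold D; ring).
      fold D in Hmax. rewrite Rpow_mult_distr in Hmax.
      assert (HDn : 0 < D ^ n) by now apply pow_lt.
      assert (H1y : 0 < (1 - y) ^ n) by (apply pow_lt; lra).
      assert (Hmax' : Cmod (g (z0 * cexp s)%C) * (1 - y) ^ n <= Cmod (g z0)).
      { apply Rmult_le_reg_r with (D ^ n); [assumption|]. nra. }
      assert (Hb : 1 <= (1 - y) ^ n * exp (INR n * (y + 2 * y ^ 2))).
      { rewrite <- exp_pow, <- Rpow_mult_distr. apply pow_R1_Rle. now apply inv_one_minus_le. }
      assert (Hgs : Cmod (g (z0 * cexp s)%C)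
        <= Cmod (g z0) * exp (INR n * (y + 2 * y ^ 2))).
      { apply Rmult_le_reg_r with ((1 - y) ^ n); [assumption|].
        eapply Rle_trans; [apply Hmax'|]. nra. }
      apply Rmult_le_reg_r with (Cmod (g z0)); [assumption|].
      unfold Rdiv. rewrite Rmult_assoc, Rinv_l, Rmult_1_r by lra.
      apply Rle_trans with (Cmod (g z0) * exp (INR n * (y + 2 * y ^ 2)) * exp (- N * fst s)).
      { apply Rmult_le_compat_r; [left; apply exp_pos|assumption]. }
      rewrite Rmult_assoc, <- exp_plus, Rmult_comm.
      apply Rmult_le_compat_r; [assumption|]. apply exp_le_compat.
      (* The linear terms cancel because [N * fst s = n * y]: this is the reason for the choice of
         [N]. *)
      replace (INR n * (y + 2 * y ^ 2) + - N * fst s) with (2 * (INR n * y ^ 2))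
        by (rewrite Ey; unfold N; field; lra).
      assert (Hyy : y ^ 2 <= (40 / INR n) ^ 2).
      { rewrite <- pow2_abs. apply pow_incr. split; [apply Rabs_pos|assumption]. }
      assert (Hm : INR n * y ^ 2 <= INR n * (40 / INR n) ^ 2) by (apply Rmult_le_compat_l; lra).
      replace (INR n * (40 / INR n) ^ 2) with (40 * (40 / INR n)) in Hm by (field; lra). lra.
    + unfold u. rewrite Cmult_cexp_0_r, Cmult_0_r, cexp_0. field. assumption.
    + unfold Rdiv in *. lra.
Qed.

(** * Comparison of the iterates *)

(** A limsup below infinity provides one tail with a supremum below infinity; replacing that
    supremum by its maximum with 1 makes the exponent positive. *)
Lemma order_finite_bound (h : C -> C) : centire h -> nonconstant h ->
  Rbar_lt (order h) p_infty ->
  exists b s0, 0 < b /\ 1 < s0 /\ forall s, s0 <= s ->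
    0 < max_modulus h s <= exp (Rpower s b).
Proof.
  intros Hh Hn Ho. destruct (max_modulus_unbounded h 3 Hh Hn) as (s1 & Hs1 & H1).
  assert (Hy : exists x, Rbar_lt (Lub_Rbar (fun v => exists r : R,
    x < r /\ v = ln (ln (max_modulus h r)) / ln r)) p_infty).
  { apply NNPP. intros Hno. apply (Rbar_lt_not_le _ _ Ho).
    unfold order, LimSup_p_infty. unfold Rbar_glb. apply (proj2 (proj2_sig (Rbar_ex_glb _))).
    intros y (x & ->). apply Rbar_not_lt_le. intros H. apply Hno. now exists x. }
  destruct Hy as (x & Hx).
  assert (Hlub := Lub_Rbar_correct (fun v => exists r : R,
    x < r /\ v = ln (ln (max_modulus h r)) / ln r)).
  assert (Hb : exists b : R, 0 < b /\ forall r, x < r -> ln (ln (max_modulus h r)) / ln r <= b).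
  { destruct (Lub_Rbar _) as [b| |].
    - exists (Rmax b 1). split; [apply Rlt_le_trans with 1; [lra|apply Rmax_r]|].
      intros r Hr. apply Rle_trans with b; [|apply Rmax_l].
      apply (proj1 Hlub). now exists r.
    - contradiction.
    - exists 1. split; [lra|]. intros r Hr.
      assert (H := proj1 Hlub _ (ex_intro _ r (conj Hr eq_refl))). contradiction. }
  destruct Hb as (b & Hb & H). exists b, (Rmax s1 (x + 1)). split; [assumption|].
  split; [apply Rlt_le_trans with s1; [lra|apply Rmax_l]|]. intros s Hs.
  assert (Ha1 := Rmax_l s1 (x + 1)). assert (Ha2 := Rmax_r s1 (x + 1)).
  specialize (H1 s ltac:(lra)). split; [lra|].
  specialize (H s ltac:(lra)).
  assert (Hls : 0 < ln s) by (rewrite <- ln_1; apply ln_increasing; lra).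
  assert (HlM : 0 < ln (max_modulus h s)) by (rewrite <- ln_1; apply ln_increasing; lra).
  rewrite <- (exp_ln (max_modulus h s)) at 1 by lra. apply exp_le_compat.
  rewrite <- (exp_ln (ln (max_modulus h s))) by assumption. apply exp_le_compat.
  apply (Rmult_le_compat_r (ln s)) in H; [|lra].
  unfold Rdiv in H. rewrite Rmult_assoc, Rinv_l, Rmult_1_r in H by lra. exact H.
Qed.

Lemma lower_order_pos_bound (h : C -> C) : centire h -> nonconstant h ->
  Rbar_lt 0 (lower_order h) ->
  exists a s0, 0 < a /\ 1 < s0 /\ forall s, s0 <= s ->
    0 < max_modulus h s /\ Rpower s a <= ln (max_modulus h s).
Proof.
  intros Hh Hn Ho. destruct (max_modulus_unbounded h 3 Hh Hn) as (s1 & Hs1 & H1).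
  assert (Hy : exists x, Rbar_lt 0 (Glb_Rbar (fun v => exists r : R,
    x < r /\ v = ln (ln (max_modulus h r)) / ln r))).
  { apply NNPP. intros Hno. apply (Rbar_lt_not_le _ _ Ho).
    unfold lower_order, LimInf_p_infty. unfold Rbar_lub. apply (proj2 (proj2_sig (Rbar_ex_lub _))).
    intros y (x & ->). apply Rbar_not_lt_le. intros H. apply Hno. now exists x. }
  destruct Hy as (x & Hx).
  assert (Hglb := Glb_Rbar_correct (fun v => exists r : R,
    x < r /\ v = ln (ln (max_modulus h r)) / ln r)).
  assert (Ha : exists a : R, 0 < a /\ forall r, x < r -> a <= ln (ln (max_modulus h r)) / ln r).
  { destruct (Glb_Rbar _) as [a| |].
    - exists a. split; [exact Hx|]. intros r Hr. apply (proj1 Hglb). now exists r.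
    - exists 1. split; [lra|]. intros r Hr.
      assert (H := proj1 Hglb _ (ex_intro _ r (conj Hr eq_refl))). contradiction.
    - contradiction. }
  destruct Ha as (a & Ha & H). exists a, (Rmax s1 (x + 1)). split; [assumption|].
  split; [apply Rlt_le_trans with s1; [lra|apply Rmax_l]|]. intros s Hs.
  assert (Ha1 := Rmax_l s1 (x + 1)). assert (Ha2 := Rmax_r s1 (x + 1)).
  specialize (H1 s ltac:(lra)). split; [lra|].
  specialize (H s ltac:(lra)).
  assert (Hls : 0 < ln s) by (rewrite <- ln_1; apply ln_increasing; lra).
  assert (HlM : 0 < ln (max_modulus h s)) by (rewrite <- ln_1; apply ln_increasing; lra).
  rewrite <- (exp_ln (ln (max_modulus h s))) by assumption. apply exp_le_compat.
  apply (Rmult_le_compat_r (ln s)) in H; [|lra].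
  unfold Rdiv in H. rewrite Rmult_assoc, Rinv_l, Rmult_1_r in H by lra. exact H.
Qed.

Lemma centire_comp (h g : C -> C) : centire h -> centire g -> centire (fun z => h (g z)).
Proof. intros Hh Hg z. apply (cdiff_comp h g); auto. Qed.

(** On the circle contained in the image of the disc, the point where [|h|] is largest is [g z] with
    [|z| <= r ^ 8]. This is the converse of [max_modulus_comp_le], at the price of a power of the
    radius. *)
Lemma max_modulus_comp_ge (h g : C -> C) :
  centire h -> centire g -> nonconstant g ->
  exists r0, 1 < r0 /\ forall r, r0 <= r -> 0 < max_modulus g r /\
    max_modulus h (max_modulus g r) <= max_modulus (fun z => h (g z)) (r ^ 8).
Proof.
  intros Hh Hg Hn.
  destruct (image_contains_circle g Hg Hn) as (r1 & Hr1 & H1).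
  destruct (max_modulus_unbounded g 1 Hg Hn) as (r2 & Hr2 & H2).
  exists (Rmax r1 r2). assert (M1 := Rmax_l r1 r2). assert (M2 := Rmax_r r1 r2).
  split; [lra|]. intros r Hr.
  destruct (H1 r ltac:(lra)) as (s & Hs & H). specialize (H2 r ltac:(lra)).
  split; [lra|].
  destruct (max_modulus_attained h s Hh ltac:(lra)) as (w & Hw & Ew).
  destruct (H w Hw) as (z & Hz & Ez).
  apply Rle_trans with (max_modulus h s); [apply max_modulus_mono; auto; lra|].
  rewrite <- Ew, <- Ez. apply (Cmod_le_max_modulus (fun z => h (g z))); auto.
  - exact (centire_comp h g Hh Hg).
  - apply pow_lt. lra.
Qed.

Lemma max_modulus_comp_le (h g : C -> C) (r : R) : centire h -> centire g ->
  0 < r -> 0 < max_modulus g r ->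
  max_modulus (fun z => h (g z)) r <= max_modulus h (max_modulus g r).
Proof.
  intros Hh Hg Hr HM.
  destruct (max_modulus_attained _ r (centire_comp h g Hh Hg) Hr) as (z & Hz & <-).
  apply Cmod_le_max_modulus; auto. apply Cmod_le_max_modulus; auto; lra.
Qed.

(** [M(r ^ 8, h o g)] exceeds [|c|] for large [r], so some value differs from [c]. *)
Lemma nonconstant_comp (h g : C -> C) : centire h -> centire g ->
  nonconstant h -> nonconstant g -> nonconstant (fun z => h (g z)).
Proof.
  intros Hh Hg Hnh Hng c.
  destruct (max_modulus_unbounded h (Cmod c + 1) Hh Hnh) as (s1 & Hs1 & H1).
  destruct (max_modulus_unbounded g s1 Hg Hng) as (r2 & Hr2 & H2).
  destruct (max_modulus_comp_ge h g Hh Hg Hng) as (r3 & Hr3 & H3).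
  set (r := Rmax r2 r3). destruct (H3 r (Rmax_r _ _)) as [_ H].
  specialize (H1 _ (H2 r (Rmax_l _ _))).
  assert (Hr : 0 < r ^ 8) by (apply pow_lt; assert (T := Rmax_l r2 r3); unfold r; lra).
  destruct (max_modulus_attained _ (r ^ 8) (centire_comp h g Hh Hg) Hr) as (z & _ & E).
  exists z. intros Ec. rewrite Ec in E. lra.
Qed.

(* With [S = M(r, g)], the left side is at most [exp (K * S ^ b)], whereas
   [M(r ^ K, f) >= M(M(r ^ (2 m), g), h) >= M(S ^ m, h) >= exp (S ^ (a m))]. *)
Lemma mu2_dominates (h g : C -> C) (eps : R) :
  centire h -> centire g -> nonconstant h -> nonconstant g ->
  Rbar_lt (order h) p_infty -> Rbar_lt 0 (lower_order h) -> 0 < eps ->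
  let f := fun z => h (g z) in
  exists (K : nat) (r0 : R), (1 <= K)%nat /\ 1 < r0 /\ forall r, r0 <= r ->
    max_modulus f r ^ K <= mu2 f eps (r ^ K).
Proof.
  intros Hh Hg Hnh Hng Ho Hlo Heps f.
  destruct (order_finite_bound h Hh Hnh Ho) as (b & s1 & Hb & Hs1 & H1).
  destruct (lower_order_pos_bound h Hh Hnh Hlo) as (a & s2 & Ha & Hs2 & H2).
  (* Ensures [m a eps >= b + 1]: the summand 1 provides a spare factor [S >= K], which absorbs the
     K-th power on the left. *)
  destruct (INR_unbounded ((b + 1) / (a * eps))) as (m & Hm).
  assert (Hae : 0 < a * eps) by now apply Rmult_lt_0_compat.
  assert (Hm0 : 0 < INR m).
  { eapply Rlt_trans; [|apply Hm]. apply Rdiv_lt_0_compat; lra. }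
  assert (Hm1 : (1 <= m)%nat) by (apply (INR_lt 0) in Hm0; lia).
  assert (Hma : b + 1 <= INR m * a * eps).
  { apply Rlt_le, (Rmult_le_compat_r (a * eps)) in Hm; [|lra].
    unfold Rdiv in Hm. rewrite Rmult_assoc, Rinv_l in Hm by lra. lra. }
  (* The factor [2 * m] comes from [max_modulus_pow], the factor 8 from [max_modulus_comp_ge]. *)
  set (K := (2 * m * 8)%nat).
  destruct (max_modulus_comp_ge h g Hh Hg Hng) as (r3 & Hr3 & H3).
  destruct (max_modulus_pow g m Hg Hng Hm1) as (r4 & Hr4 & H4).
  set (S0 := Rmax (Rmax s1 s2) (INR K)).
  assert (HS1 : s1 <= S0) by (eapply Rle_trans; [apply Rmax_l|apply Rmax_l]).
  assert (HS2 : s2 <= S0) by (eapply Rle_trans; [apply Rmax_r|apply Rmax_l]).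
  assert (HS3 : INR K <= S0) by apply Rmax_r.
  destruct (max_modulus_unbounded g S0 Hg Hng) as (r5 & Hr5 & H5).
  exists K, (Rmax (Rmax r3 r4) r5). split; [unfold K; lia|].
  assert (M3 : r3 <= Rmax (Rmax r3 r4) r5) by (eapply Rle_trans; [apply Rmax_l|apply Rmax_l]).
  assert (M4 : r4 <= Rmax (Rmax r3 r4) r5) by (eapply Rle_trans; [apply Rmax_r|apply Rmax_l]).
  assert (M5 : r5 <= Rmax (Rmax r3 r4) r5) by apply Rmax_r.
  split; [lra|]. intros r Hr.
  specialize (H4 r ltac:(lra)). specialize (H5 r ltac:(lra)).
  assert (Hr2m : r <= r ^ (2 * m)).
  { rewrite <- (pow_1 r) at 1. apply Rle_pow; [lra|lia]. }
  destruct (H3 (r ^ (2 * m)) ltac:(lra)) as [_ H3'].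
  rewrite <- pow_mult in H3'. fold K f in H3'.
  set (S := max_modulus g r) in *.
  assert (HSm : S <= S ^ m).
  { rewrite <- (pow_1 S) at 1. apply Rle_pow; [lra|lia]. }
  destruct (H2 (S ^ m) ltac:(lra)) as [Hp2 H2'].
  assert (HMR : max_modulus h (S ^ m) <= max_modulus f (r ^ K)).
  { eapply Rle_trans; [|apply H3']. apply max_modulus_mono; auto; lra. }
  assert (HlM : Rpower (S ^ m) a <= ln (max_modulus f (r ^ K))).
  { eapply Rle_trans; [apply H2'|]. now apply ln_le. }
  assert (HMr : max_modulus f r <= exp (Rpower S b)).
  { eapply Rle_trans; [apply (max_modulus_comp_le h g); auto; fold S; lra|].
    apply H1. fold S. lra. }
  assert (HlS : 0 < ln S) by (rewrite <- ln_1; apply ln_increasing; lra).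
  assert (Hf0 : 0 <= max_modulus f r).
  { apply max_modulus_nonneg; [exact (centire_comp h g Hh Hg)|lra]. }
  apply Rle_trans with (exp (Rpower S b) ^ K); [apply pow_incr; lra|].
  rewrite exp_pow. unfold mu2. apply exp_le_compat. unfold pos_power.
  assert (HRp : 0 < Rpower (S ^ m) a) by apply exp_pos.
  destruct (Rlt_dec 0 _) as [Hpos|Hneg]; [|lra].
  apply Rle_trans with (Rpower (Rpower (S ^ m) a) eps).
  - apply Rle_trans with (S * Rpower S b).
    + apply Rmult_le_compat_r; [left; apply exp_pos|lra].
    + unfold Rpower. rewrite ln_exp, ln_pow by lra.
      rewrite <- (exp_ln S) at 1 by lra. rewrite <- exp_plus. apply exp_le_compat.
      replace (eps * (a * (INR m * ln S))) with (INR m * a * eps * ln S) by ring.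
      apply (Rmult_le_compat_r (ln S)) in Hma; lra.
  - apply Rle_Rpower_l; lra.
Qed.

(** * Unboundedness of the iterates *)

(** A maximal point on [|z| = L] is moved radially inwards. Continuity from the left is what a
    bounded increasing sequence of iterates calls for. *)
Lemma max_modulus_lsc (f : C -> C) (L y : R) : centire f -> 0 < L -> y < max_modulus f L ->
  exists d, 0 < d /\ forall r, 0 < r -> L - d < r <= L -> y < max_modulus f r.
Proof.
  intros Hf HL Hy. destruct (max_modulus_attained f L Hf HL) as (z & Hz & E).
  destruct (cdiff_ccont f z (Hf z) (max_modulus f L - y) ltac:(lra)) as (d & Hd & H).
  exists d. split; [assumption|]. intros r Hr0 Hr.
  set (w := (RtoC (r / L) * z)%C).
  assert (Hq : 0 < r / L) by now apply Rdiv_lt_0_compat.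
  assert (Hw : Cmod w = r).
  { unfold w. rewrite Cmod_mult, Cmod_R, Rabs_pos_eq, Hz by lra. field. lra. }
  assert (Hwz : Cmod (w - z) < d).
  { replace (w - z)%C with (RtoC ((r - L) / L) * z)%C.
    - rewrite Cmod_mult, Cmod_R, Hz. unfold Rdiv. rewrite Rabs_mult.
      rewrite (Rabs_pos_eq (/ L)) by (left; now apply Rinv_0_lt_compat).
      rewrite Rmult_assoc, Rinv_l, Rmult_1_r by lra. apply Rabs_def1; lra.
    - unfold w. replace ((r - L) / L) with (r / L - 1) by (field; lra).
      rewrite RtoC_minus. ring. }
  specialize (H w Hwz). assert (T := Cmod_triangle_rev (f z) (f w)).
  rewrite Cmod_minus_sym in T.
  assert (T' := Cmod_le_max_modulus f r w Hf Hr0 ltac:(lra)). lra.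
Qed.

Lemma iter_ge (m : R -> R) (R0 : R) : (forall r, R0 <= r -> r < m r) ->
  forall n, R0 <= Nat.iter n m R0.
Proof.
  intros H n. induction n as [|n IH]; [cbn; lra|].
  cbn [Nat.iter nat_rect]. specialize (H _ IH). unfold Nat.iter in *. lra.
Qed.

(** If the iterates had a supremum [L], one of them would lie so close below [L] that its image
    exceeds [L]. *)
Lemma iter_unbounded (m : R -> R) (R0 B : R) : (forall r, R0 <= r -> r < m r) ->
  (forall L, R0 <= L -> exists d, 0 < d /\ forall r, R0 <= r -> L - d < r <= L -> L < m r) ->
  exists n, B <= Nat.iter n m R0.
Proof.
  intros Hm Hlsc. apply NNPP. intros Hno.
  assert (HB : forall n, Nat.iter n m R0 <= B).
  { intros n. apply Rnot_lt_le. intros H. apply Hno. exists n. lra. }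
  destruct (completeness (fun y => exists n, y = Nat.iter n m R0)) as (L & HL1 & HL2).
  - exists B. intros y (n & ->). apply HB.
  - exists R0, 0%nat. reflexivity.
  - assert (HL : forall n, Nat.iter n m R0 <= L) by (intros n; apply HL1; now exists n).
    destruct (Hlsc L (HL 0%nat)) as (d & Hd & H).
    assert (Hn : exists n, L - d < Nat.iter n m R0).
    { apply NNPP. intros Hno'. assert (L <= L - d); [|lra].
      apply HL2. intros y (n & ->). apply Rnot_lt_le. intros H'. apply Hno'. now exists n. }
    destruct Hn as (n & Hn).
    specialize (H _ (iter_ge m R0 Hm n) (conj Hn (HL n))).
    specialize (HL (S n)). cbn [Nat.iter nat_rect] in HL. unfold Nat.iter in *. lra.
Qed.

Lemma max_modulus_iter_unbounded (f : C -> C) (R0 B : R) : centire f ->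
  max_modulus_admissible f R0 -> exists n, B <= Nat.iter n (max_modulus f) R0.
Proof.
  intros Hf [HR0 H]. apply iter_unbounded; [assumption|]. intros L HL.
  destruct (max_modulus_lsc f L L Hf ltac:(lra) (H L HL)) as (d & Hd & Hl).
  exists d. split; [assumption|]. intros r Hr Hr'. apply Hl; lra.
Qed.

Lemma pos_power_nonneg (x e : R) : 0 <= pos_power x e.
Proof. unfold pos_power. destruct (Rlt_dec 0 x); [left; apply exp_pos|lra]. Qed.

Lemma mu2_ge_1 (f : C -> C) (eps r : R) : 1 <= mu2 f eps r.
Proof. unfold mu2. rewrite <- exp_0. apply exp_le_compat, pos_power_nonneg. Qed.

Lemma mu2_eq (f : C -> C) (eps r : R) : 1 < max_modulus f r ->
  mu2 f eps r = exp (Rpower (ln (max_modulus f r)) eps).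
Proof.
  intros H. unfold mu2, pos_power. destruct (Rlt_dec 0 _) as [|n]; [reflexivity|].
  elim n. rewrite <- ln_1. apply ln_increasing; lra.
Qed.

Lemma mu2_mono (f : C -> C) (eps r s : R) : centire f -> 0 < eps -> 0 < r <= s ->
  1 <= max_modulus f r -> mu2 f eps r <= mu2 f eps s.
Proof.
  intros Hf He Hrs H1. assert (HM := max_modulus_mono f r s Hf Hrs).
  destruct H1 as [H1|H1].
  - rewrite !mu2_eq by lra. apply exp_le_compat, Rle_Rpower_l; [lra|]. split.
    + rewrite <- ln_1. apply ln_increasing; lra.
    + apply ln_le; lra.
  - unfold mu2 at 1. rewrite <- H1, ln_1. unfold pos_power.
    destruct (Rlt_dec 0 0); [lra|]. rewrite exp_0. apply mu2_ge_1.
Qed.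

Lemma mu2_le_max_modulus (f : C -> C) (eps r : R) : 0 < eps < 1 -> 3 <= max_modulus f r ->
  mu2 f eps r <= max_modulus f r.
Proof.
  intros He H3. rewrite mu2_eq by lra. rewrite <- (exp_ln (max_modulus f r)) at 2 by lra.
  apply exp_le_compat.
  assert (Hl : 1 <= ln (max_modulus f r)).
  { rewrite <- (ln_exp 1). apply ln_le; [apply exp_pos|]. assert (H := exp_le_3). lra. }
  rewrite <- (Rpower_1 (ln (max_modulus f r))) at 2 by lra. apply Rle_Rpower; lra.
Qed.

Lemma mu2_iter_unbounded (f : C -> C) (eps R0 B : R) : centire f -> 0 < eps ->
  mu2_admissible f eps R0 -> exists n, B <= Nat.iter n (mu2 f eps) R0.
Proof.
  intros Hf He [HR0 H]. apply iter_unbounded; [intros r Hr; now apply H|]. intros L HL.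
  destruct (H L HL) as [[HM|HM] HL1].
  - rewrite mu2_eq in HL1 by assumption.
    assert (Hc : continuity_pt (fun y => exp (Rpower (ln y) eps)) (max_modulus f L)).
    { apply derivable_continuous_pt, ex_derive_Reals_0. unfold Rpower. auto_derive.
      split; [lra|]. split; [|exact I].
      rewrite <- ln_1. apply ln_increasing; lra. }
    destruct (Hc (exp (Rpower (ln (max_modulus f L)) eps) - L) ltac:(lra)) as (e & Hep & Hcont).
    (* Exceeding [y] keeps [M(r, f)] within [e] of [M(L, f)] and above 1, where the formula [mu2_eq]
       is valid. *)
    set (y := Rmax 1 (max_modulus f L - e)).
    assert (Hy1 := Rmax_l 1 (max_modulus f L - e)). assert (Hy2 := Rmax_r 1 (max_modulus f L - e)).
    fold y in Hy1, Hy2.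
    assert (Hy : y < max_modulus f L) by (apply Rmax_lub_lt; lra).
    destruct (max_modulus_lsc f L y Hf ltac:(lra) Hy) as (d & Hd & Hl).
    exists d. split; [assumption|]. intros r Hr Hr'.
    specialize (Hl r ltac:(lra) Hr').
    assert (Hmono := max_modulus_mono f r L Hf ltac:(lra)).
    rewrite mu2_eq by lra.
    destruct (Req_dec (max_modulus f L) (max_modulus f r)) as [E|Hne]; [now rewrite <- E|].
    specialize (Hcont (max_modulus f r)). cbn in Hcont. unfold Rdist in Hcont.
    assert (HH := Hcont ltac:(split; [split; [exact I|exact Hne]|apply Rabs_def1; lra])).
    apply Rabs_def2 in HH. lra.
  (* If [M(L, f) = 1], then [mu2] equals 1 at [L], so [L < 1], and [mu2 >= 1] everywhere. *)
  - unfold mu2 in HL1. rewrite <- HM, ln_1 in HL1. unfold pos_power in HL1.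
    destruct (Rlt_dec 0 0) as [?|_] in HL1; [lra|]. rewrite exp_0 in HL1.
    exists 1. split; [lra|]. intros r _ _. assert (T := mu2_ge_1 f eps r). lra.
Qed.

Lemma iter_max_modulus_mono (f : C -> C) (r s : R) (n : nat) : centire f ->
  max_modulus_admissible f r -> r <= s ->
  Nat.iter n (max_modulus f) r <= Nat.iter n (max_modulus f) s.
Proof.
  intros Hf [Hr H] Hrs. induction n as [|n IH]; [exact Hrs|].
  cbn [Nat.iter nat_rect]. apply max_modulus_mono; [assumption|]. split; [|exact IH].
  assert (T := iter_ge (max_modulus f) r H n). unfold Nat.iter in T. lra.
Qed.

Lemma pow_root (s : R) (K : nat) : 0 < s -> (1 <= K)%nat -> Rpower s (/ INR K) ^ K = s.
Proof.
  intros Hs HK. assert (0 < INR K) by (apply lt_0_INR; lia).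
  rewrite <- Rpower_pow by apply exp_pos. rewrite Rpower_mult, Rinv_l by lra.
  now apply Rpower_1.
Qed.

Lemma pow_lt_compat (x y : R) (n : nat) : 0 <= x < y -> (1 <= n)%nat -> x ^ n < y ^ n.
Proof.
  intros Hxy Hn. induction Hn as [|n Hn IH]; [lra|]. cbn [pow].
  apply Rmult_le_0_lt_compat; try lra. apply pow_le. lra.
Qed.

(** The domination hypothesis says that the substitution of [r ^ K] for [r] carries [M] below [mu2];
    induction then gives [M^n(S0) ^ K <= mu2^(n + N)(R1)]. Differences between starting radii are
    absorbed by finitely many iterates, that is by enlarging [l]. *)
Lemma Q2_iff_fast_escaping (f : C -> C) (R0 : R) (z : C) :
  centire f -> nonconstant f ->
  (forall eps, 0 < eps -> exists (K : nat) (r0 : R), (1 <= K)%nat /\ 1 < r0 /\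
     forall r, r0 <= r -> max_modulus f r ^ K <= mu2 f eps (r ^ K)) ->
  max_modulus_admissible f R0 ->
  Q2 f z <-> fast_escaping f R0 z.
Proof.
  intros Hf Hn Hdom HA. destruct (max_modulus_unbounded f 3 Hf Hn) as (r1 & Hr1 & H3).
  assert (HA' := HA). destruct HA' as [HR0 HM]. split.
  - intros (eps & l & R1 & He & Hadm & Hz).
    destruct (Hdom eps ltac:(lra)) as (K & r0 & HK & Hr0 & H).
    set (S0 := Rmax (Rmax r0 r1) R0).
    assert (HS0 : r0 <= S0) by (eapply Rle_trans; [apply Rmax_l|apply Rmax_l]).
    assert (HS1 : r1 <= S0) by (eapply Rle_trans; [apply Rmax_r|apply Rmax_l]).
    assert (HS2 : R0 <= S0) by apply Rmax_r.
    (* After [N] steps the orbit of [R1] has passed [S0 ^ K], where the induction can start. *)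
    destruct (mu2_iter_unbounded f eps R1 (S0 ^ K) Hf ltac:(lra) Hadm) as (N & HN).
    assert (HSM : forall r, S0 <= r -> r < max_modulus f r) by (intros r Hr; apply HM; lra).
    assert (Hpow : forall x, S0 <= x -> x <= x ^ K).
    { intros x Hx. rewrite <- (pow_1 x) at 1. apply Rle_pow; [lra|lia]. }
    assert (Hind : forall n, Nat.iter n (max_modulus f) S0 ^ K <= Nat.iter (n + N) (mu2 f eps) R1).
    { induction n as [|n IH]; [exact HN|].
      assert (Hx := iter_ge (max_modulus f) S0 HSM n).
      cbn [Nat.iter nat_rect Nat.add] in *. unfold Nat.iter in *.
      set (x := nat_rect _ _ _ n) in *. set (y := nat_rect _ _ _ (n + N)) in *.
      assert (Hp := Hpow x Hx).
      eapply Rle_trans; [apply H; lra|]. apply mu2_mono; auto; [lra|lra|].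
      assert (T := H3 (x ^ K)). lra. }
    exists (N + l)%nat. intros n.
    eapply Rle_trans; [apply (iter_max_modulus_mono f R0 S0 n Hf HA HS2)|].
    eapply Rle_trans; [apply Hpow, (iter_ge (max_modulus f) S0 HSM n)|].
    eapply Rle_trans; [apply Hind|]. rewrite Nat.add_assoc. apply Hz.
  (* Any exponent in (0, 1) would serve. Domination is used here only to produce an admissible
     starting radius; the iterates are compared by [mu2 <= M]. *)
  - intros (l & Hz). destruct (Hdom (1 / 2) ltac:(lra)) as (K & r0 & HK & Hr0 & H).
    set (S0 := Rmax (Rmax r0 r1) R0).
    assert (HS0 : r0 <= S0) by (eapply Rle_trans; [apply Rmax_l|apply Rmax_l]).
    assert (HS1 : r1 <= S0) by (eapply Rle_trans; [apply Rmax_r|apply Rmax_l]).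
    assert (HS2 : R0 <= S0) by apply Rmax_r.
    assert (HSK : S0 <= S0 ^ K).
    { rewrite <- (pow_1 S0) at 1. apply Rle_pow; [lra|lia]. }
    (* With [s = r ^ K], admissibility of [R0] for [M] gives [s < M(r, f) ^ K], and domination gives
       [M(r, f) ^ K <= mu2 s]. *)
    assert (Hadm : forall s, S0 ^ K <= s -> s < mu2 f (1 / 2) s).
    { intros s Hs. set (r := Rpower s (/ INR K)).
      assert (Er : r ^ K = s) by (apply pow_root; [lra|assumption]).
      assert (Hr : S0 <= r).
      { apply Rnot_lt_le. intros Hlt. assert (T : r ^ K < S0 ^ K); [|lra].
        apply pow_lt_compat; [split; [left; apply exp_pos|assumption]|assumption]. }
      rewrite <- Er. eapply Rlt_le_trans; [|apply H; lra].
      apply pow_lt_compat; [|assumption]. assert (T := HM r ltac:(lra)). lra. }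
    destruct (max_modulus_iter_unbounded f R0 (S0 ^ K) Hf HA) as (N & HN).
    assert (Hind : forall n, Nat.iter n (mu2 f (1 / 2)) (S0 ^ K)
      <= Nat.iter (n + N) (max_modulus f) R0).
    { induction n as [|n IH]; [exact HN|].
      assert (Hx := iter_ge (mu2 f (1 / 2)) (S0 ^ K) Hadm n).
      cbn [Nat.iter nat_rect Nat.add] in *. unfold Nat.iter in *.
      set (x := nat_rect _ _ _ n) in *. set (y := nat_rect _ _ _ (n + N)) in *.
      eapply Rle_trans; [apply mu2_le_max_modulus; [lra|apply H3; lra]|].
      apply max_modulus_mono; [assumption|lra]. }
    exists (1 / 2), (N + l)%nat, (S0 ^ K). split; [lra|]. split.
    + split; [lra|]. intros r Hr. split; [|now apply Hadm].
      assert (T := H3 r ltac:(lra)). lra.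
    + intros n. eapply Rle_trans; [apply Hind|]. rewrite Nat.add_assoc. apply Hz.
Qed.

(** * Finite compositions *)

(** The recursion of [compose] peels off the innermost function, whereas the growth hypotheses
    concern the outermost one. *)
Lemma compose_first (F : nat -> C -> C) (k : nat) (z : C) :
  compose F (S k) z = F 1%nat (compose (fun i => F (S i)) k z).
Proof.
  revert z. induction k as [|k IH]; intros z; [reflexivity|].
  change (compose F (S (S k)) z) with (compose F (S k) (F (S (S k)) z)).
  rewrite IH. reflexivity.
Qed.

(** The empty composition, the identity, is included: it is the inner function g when [j = 1]. *)
Lemma centire_nonconstant_compose (F : nat -> C -> C) (k : nat) :
  (forall i, (1 <= i <= k)%nat -> centire (F i) /\ nonconstant (F i)) ->
  centire (compose F k) /\ nonconstant (compose F k).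
Proof.
  induction k as [|k IH]; intros HF.
  - split.
    + intros z. apply cdiff_id.
    + intros c. exists (c + 1)%C. cbn [compose]. intros E.
      apply (f_equal (fun v => v - c)%C) in E.
      replace (c + 1 - c)%C with (RtoC 1) in E by ring.
      replace (c - c)%C with (RtoC 0) in E by ring. apply RtoC_inj in E. lra.
  - destruct IH as [H1 H2]; [intros i Hi; apply HF; lia|].
    destruct (HF (S k) ltac:(lia)) as [H3 H4]. split.
    + exact (centire_comp _ _ H1 H3).
    + exact (nonconstant_comp _ _ H1 H3 H2 H4).
Qed.

Lemma transcendental_entire_spec (f : C -> C) : transcendental_entire f ->
  centire f /\ nonconstant f.
Proof.
  intros [He Hp]. split.
  - intros z. apply cdiff_of_ex_derive, He.
  (* A constant function is a polynomial of degree at most 0. *)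
  - intros c. apply NNPP. intros Hno. apply Hp. exists (fun _ => c), 0%nat. intros z.
    rewrite sum_O. replace (c * z ^ 0)%C with c by (cbn; ring).
    apply NNPP. intros Hz. apply Hno. now exists z.
Qed.

Theorem theorem1p1 :
  forall (j : nat) (F : nat -> C -> C),
    (1 <= j)%nat ->
    (forall i : nat, (1 <= i <= j)%nat -> transcendental_entire (F i)) ->
    Rbar_lt (order (F 1%nat)) p_infty ->
    Rbar_lt (Finite 0) (lower_order (F 1%nat)) ->
    forall R0 : R, max_modulus_admissible (compose F j) R0 ->
    forall z : C, Q2 (compose F j) z <-> fast_escaping (compose F j) R0 z.
Proof.
  intros [|k] F Hj HF Ho Hlo R0 HA z; [lia|].
  set (g := compose (fun i => F (S i)) k).
  destruct (transcendental_entire_spec _ (HF 1%nat ltac:(lia))) as [Hh Hnh].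
  destruct (centire_nonconstant_compose (fun i => F (S i)) k) as [Hg Hng].
  { intros i Hi. apply transcendental_entire_spec, HF. lia. }
  fold g in Hg, Hng.
  assert (E : compose F (S k) = fun z => F 1%nat (g z)).
  { apply functional_extensionality. intros w. apply compose_first. }
  rewrite E in *. apply Q2_iff_fast_escaping; [| | |assumption].
  - exact (centire_comp _ _ Hh Hg).
  - exact (nonconstant_comp _ _ Hh Hg Hnh Hng).
  - intros eps Heps. now apply (mu2_dominates (F 1%nat) g).
Qed.
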